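(* Let $1\le p,q\le\infty$ with $\frac1p+\frac1q\le1$, let $X_1,\dots,X_n,Y$ be Banach spaces and let $\beta$ be a reasonable crossnorm on $X_1\otimes\dots\otimes X_n$. Then $$(X_1\otimes\dots\otimes X_n\otimes Y,\alpha_{q^*,p^*}^\beta)^*=\mathcal D_{p,q}^\beta(X_1,\dots,X_n;Y^* )$$ holds isometrically isomorphically, where $T\in\mathcal D_{p,q}^\beta(X_1,\dots,X_n;Y^* )$, normed by $D_{p,q}^\beta$, is identified with the linear functional determined by $x^1\otimes\dots\otimes x^n\otimes y\mapsto\langle T(x^1,\dots,x^n),y\rangle$.
   Context: All Banach spaces are over the same field $\mathbb K\in\{\mathbb R,\mathbb C\}$; $s^*$ is the conjugate exponent of $s\in[1,\infty]$; $B_X$ is the closed unit ball. A norm $\beta$ on the algebraic tensor product $X_1\otimes\dots\otimes X_n$ is a reasonable crossnorm if $\varepsilon(u)\le\beta(u)\le\pi(u)$ for all $u$, where $\varepsilon$ and $\pi$ are the injective and projective tensor norms. $\Sigma_{X_1\dots X_n}=\{x^1\otimes\dots\otimes x^n:x^i\in X_i\}$. $\mathcal L^\beta(X_1,\dots,X_n)$ is the Banach space of multilinear forms $\varphi$ whose linearization $\widetilde\varphi:(X_1\otimes\dots\otimes X_n,\beta)\to\mathbb K$ is bounded, with norm $\|\varphi\|_\beta=\|\widetilde\varphi\|$. For finite sequences $(a_i),(b_i)$ in $\Sigma_{X_1\dots X_n}$ and $(e_i)$ in a Banach space $E$: $\|(a_i-b_i)_{i=1}^m\|_s^{w,\beta}=\sup_{\varphi\in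 B_{\mathcal L^\beta(X_1,\dots,X_n)}}\big(\sum_i|\widetilde\varphi(a_i)-\widetilde\varphi(b_i)|^s\big)^{1/s}$ and $\|(e_i)_{i=1}^m\|_s^w=\sup_{e^*\in B_{E^*}}\big(\sum_i|e^*(e_i)|^s\big)^{1/s}$ (maxima over $i$ if $s=\infty$). Let $r\in[1,\infty]$ be determined by $1=\frac1r+\frac1p+\frac1q$. For a Banach space $V$, a multilinear $T:X_1\times\dots\times X_n\to V$ is $\beta$-$(p,q)$-dominated if there is $C>0$ with $$\|(\langle v_i^*,T(x_i^1,\dots,x_i^n)-T(z_i^1,\dots,z_i^n)\rangle)_{i=1}^m\|_{r^*}\le C\,\|(x_i^1\otimes\dots\otimes x_i^n-z_i^1\otimes\dots\otimes z_i^n)_{i=1}^m\|_p^{w,\beta}\,\|(v_i^* )_{i=1}^m\|_q^w$$ for all finite sequences $(x_i^1,\dots,x_i^n)_{i=1}^m,(z_i^1,\dots,z_i^n)_{i=1}^m$ in $X_1\times\dots\times X_n$ and $(v_i^* )_{i=1}^m$ in $V^*$; $D_{p,q}^\beta(T)$ is the infimum of such $C$, and $\mathcal D_{p,q}^\beta(X_1,\dots,X_n;V)$ is the vector space of all such operators (pointwise operations) with the norm $D_{p,q}^\beta$. Here $V=Y^*$, so $v_i^*\in Y^{**}$. For $1\le s,t\le\infty$ with $\frac1s+\frac1t\ge1$ and $\rho\in[1,\infty]$ determined by $1=\frac1\rho+\frac1{t^*}+\frac1{s^*}$, the Laprest\'e norm on $X_1\otimes\dots\otimes X_n\otimes Y$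 is $\alpha_{s,t}^\beta(u)=\inf\{\|(\lambda_i)\|_\rho\|(a_i-b_i)\|_{t^*}^{w,\beta}\|(y_i)\|_{s^*}^w\}$, the infimum over all representations $u=\sum_{i=1}^m\lambda_i(a_i-b_i)\otimes y_i$ with $\lambda_i\in\mathbb K$, $a_i,b_i\in\Sigma_{X_1\dots X_n}$, $y_i\in Y$. Thus $\alpha_{q^*,p^*}^\beta(u)=\inf\|(\lambda_i)\|_r\|(a_i-b_i)\|_p^{w,\beta}\|(y_i)\|_q^w$. *)

(* Defs.v *)
From HB Require Import structures.
From mathcomp Require Import all_boot all_order all_algebra.
From mathcomp Require Import complex.
From mathcomp Require Import all_classical all_reals all_analysis.
From mathcomp Require Import lra.

Set Implicit Arguments.
Unset Strict Implicit.
Unset Printing Implicit Defensive.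

Import Order.TTheory GRing.Theory Num.Theory.
Import numFieldNormedType.Exports.

Local Open Scope classical_set_scope.
Local Open Scope ring_scope.

Inductive scalar_kind := RealScalars | ComplexScalars.

Definition scalars (R : realType) (k : scalar_kind) : numFieldType :=
  match k with
  | RealScalars => R : numFieldType
  | ComplexScalars => (R[i])%C : numFieldType
  end.

(* In a [normedModType K] the norm takes its values in K, even when K is the
   field of complex numbers: [realval] reads it as a real number. *)
Definition realval (R : realType) (k : scalar_kind) : scalars R k -> R :=
  match k return scalars R k -> R with
  | RealScalars => fun t => t
  | ComplexScalars => fun t => complex.Re t
  end.

Definition modulus (R : realType) (k : scalar_kind) (t : scalars R k) : R :=
  realval `|t|.

Definition vnorm (R : realType) (k : scalar_kind)
  (E : normedModType (scalars R k)) (x : E) : R := realval `|x|.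

Section modulus_theory.
Context (R : realType) (k : scalar_kind).
Implicit Types a b : scalars R k.

Lemma modulus_ge0 a : 0 <= modulus a.
Proof.
rewrite /modulus; move: a; case: k => /= a; first exact: normr_ge0.
by have := normr_ge0 a; rewrite lecE => /andP[].
Qed.

Lemma modulus0 : modulus (0 : scalars R k) = 0.
Proof. by rewrite /modulus normr0; case: k. Qed.

Lemma modulusD a b : modulus (a + b) <= modulus a + modulus b.
Proof.
rewrite /modulus; move: a b; case: k => /= a b; first exact: ler_normD.
have := ler_normD a b; rewrite lecE => /andP[_].
by rewrite raddfD.
Qed.

Lemma modulusM a b : modulus (a * b) = modulus a * modulus b.
Proof.
rewrite /modulus normrM; move: a b; case: k => //= a b.
have h (c : (R[i])%C) : complex.Im `|c| = 0.
  by have := normr_ge0 c; rewrite lecE => /andP[/eqP].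
have e (c d : (R[i])%C) : complex.Re (c * d) =
    complex.Re c * complex.Re d - complex.Im c * complex.Im d.
  by case: c; case: d.
have := e `|a| `|b|; rewrite !h mul0r subr0; exact.
Qed.

End modulus_theory.

Section lnorm.
Context (R : realType).
Local Open Scope ereal_scope.

Definition lnorm (s : \bar R) (m : nat) (a : 'I_m -> R) : R :=
  (match s with
   | s%:E => (\sum_(i < m) `|a i| `^ s) `^ s^-1
   | +oo%E => \big[Num.max/0]_(i < m) `|a i|
   | -oo%E => 0
   end)%R.

(* The exponent determined by 1 = 1/r + 1/p + 1/q. *)
Definition residual_exponent (p q : \bar R) : \bar R := (1 - p^-1 - q^-1)^-1.

Lemma residual_conj_gt0 (p q : \bar R) :
  1 <= p -> 1 <= q -> p^-1 + q^-1 <= 1 ->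
  0 < hoelder_conjugate (residual_exponent p q).
Proof.
move=> p1 q1 pq; rewrite (lt_le_trans lte01)//; apply: hoelder_conj_ge1.
have [p0 q0] : 0 <= p /\ 0 <= q by split; exact: le_trans lee01 _.
have p0' : 0 <= p^-1 by rewrite inve_ge0.
have q0' : 0 <= q^-1 by rewrite inve_ge0.
have pf : p^-1 \is a fin_num.
  by rewrite ge0_fin_numE // (@le_lt_trans _ _ 1) ?ltry// (le_trans _ pq)// leeDl.
have qf : q^-1 \is a fin_num.
  by rewrite ge0_fin_numE // (@le_lt_trans _ _ 1) ?ltry// (le_trans _ pq)// leeDr.
rewrite /residual_exponent inve_ge1.
  by move: p0' q0'; rewrite -(fineK pf) -(fineK qf) !lee_fin; lra.
by move: pq; rewrite -(fineK pf) -(fineK qf) !lee_fin; lra.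
Qed.

Lemma lnorm_quasi (s : \bar R) : 0 < s ->
  exists2 c : R, (0 < c)%R &
    forall (l : R) m (a b d : 'I_m -> R), (0 <= l)%R ->
      (forall i, `|d i| <= l * `|a i| + `|b i|)%R ->
      (lnorm s d <= c * (l * lnorm s a + lnorm s b))%R.
Proof.
case: s => [s| |] //=; last first.
  move=> _; exists 1%R => // l m a b d l0 h; rewrite mul1r.
  apply: bigmax_le => [|i _].
    by rewrite addr_ge0 ?mulr_ge0 ?bigmax_ge_id.
  apply: le_trans (h i) _; apply: lerD; last exact: le_bigmax.
  by apply: ler_wpM2l => //; exact: le_bigmax.
rewrite lte_fin => s0.
have s'0 : (0 <= s^-1)%R by rewrite invr_ge0 ltW.
exists ((2 `^ s * 2) `^ s^-1)%R => [|l m a b d l0 h].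
  by rewrite powR_gt0// mulr_gt0// powR_gt0.
set A := (\sum_(i < m) `|a i| `^ s)%R; set B := (\sum_(i < m) `|b i| `^ s)%R.
set A' := (l `^ s * A)%R.
have A0 : (0 <= A)%R by apply: sumr_ge0 => i _; exact: powR_ge0.
have B0 : (0 <= B)%R by apply: sumr_ge0 => i _; exact: powR_ge0.
have A'0 : (0 <= A')%R by rewrite mulr_ge0// powR_ge0.
have lK : (l * A `^ s^-1 = A' `^ s^-1)%R.
  by rewrite powRM ?powR_ge0// -powRrM mulfV ?gt_eqF// powRr1.
have step : (\sum_(i < m) `|d i| `^ s <= 2 `^ s * 2 * Num.max A' B)%R.
  apply: (@le_trans _ _ (2 `^ s * (A' + B))%R).
    rewrite /A' !mulr_sumr -big_split/= mulr_sumr; apply: ler_sum => i _.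
    set M := Num.max (l * `|a i|)%R `|b i|%R.
    have M0 : (0 <= M)%R by rewrite le_max normr_ge0 orbT.
    apply: (@le_trans _ _ ((2 * M) `^ s)%R).
      apply: (ge0_ler_powR (ltW s0)); rewrite ?nnegrE ?normr_ge0 ?mulr_ge0 //.
      apply: le_trans (h i) _; rewrite mulr_natl mulr2n.
      by apply: lerD; rewrite le_max lexx ?orbT.
    rewrite powRM// ler_wpM2l ?powR_ge0// -powRM//.
    have : (0 <= (l * `|a i|) `^ s)%R by exact: powR_ge0.
    have : (0 <= `|b i| `^ s)%R by exact: powR_ge0.
    by rewrite /M; case: (leP (l * `|a i|)%R `|b i|%R) => _; lra.
  rewrite -mulrA ler_wpM2l ?powR_ge0// mulr_natl mulr2n.
  by apply: lerD; rewrite le_max lexx ?orbT.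
have Mx0 : (0 <= Num.max A' B)%R by rewrite le_max A'0.
apply: le_trans (ge0_ler_powR s'0 _ _ step) _.
- by rewrite nnegrE; apply: sumr_ge0 => i _; exact: powR_ge0.
- by rewrite nnegrE !mulr_ge0// powR_ge0.
rewrite powRM// ?mulr_ge0 ?powR_ge0// ler_wpM2l ?powR_ge0// lK.
have : (0 <= A' `^ s^-1)%R by exact: powR_ge0.
have : (0 <= B `^ s^-1)%R by exact: powR_ge0.
by case: (leP A' B) => _ b0 a0; rewrite ?lerDr ?lerDl.
Qed.

Lemma sup_set_ge0 (A : set R) : (forall x, A x -> (0 <= x)%R) -> (0 <= sup A)%R.
Proof.
move=> A0; have [supA|/sup_out ->//] := pselect (has_sup A).
have [x Ax] := supA.1.
by apply: le_trans (A0 _ Ax) _; apply: ub_le_sup Ax; exact: supA.2.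
Qed.

Lemma lnorm_ge0 s m (a : 'I_m -> R) : (0 <= lnorm s a)%R.
Proof.
case: s => [s| |] //=; first exact: powR_ge0.
by elim/big_ind: _ => // x y x0 y0; rewrite le_max x0.
Qed.

Lemma lnorm0 s m : 0 < s -> lnorm s (fun _ : 'I_m => 0%R) = 0%R.
Proof.
case: s => [s| |] //=.
  rewrite lte_fin => s0; rewrite big1 ?powR0 ?invr_eq0 ?gt_eqF// => i _.
  by rewrite normr0 powR0 // gt_eqF.
by move=> _; elim/big_ind: _ => // [x y -> ->|i _]; rewrite ?maxxx ?normr0.
Qed.

End lnorm.

(* A normed space is presented below as a vector space E with a function
   N : E -> R; this covers Banach spaces (N = vnorm), duals (N = opnorm) and
   tensor products under a tensor norm. *)
Section dual.
Context (R : realType) (k : scalar_kind).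
Local Notation K := (scalars R k).

Section dual_space.
Context (E : lmodType K) (N : E -> R).

Definition bounded_for (f : E -> K) : Prop :=
  exists C : R, forall x, modulus (f x) <= C * N x.

Definition opnorm (f : E -> K) : R :=
  sup [set modulus (f x) | x in [set x | N x <= 1]].

Definition dual_pred : {pred E -> K^o} :=
  fun f => `[< scalar f /\ bounded_for f >].

Lemma dual_submod_closed : submod_closed dual_pred.
Proof.
split=> [|a f g /asboolP[fl [C hC]] /asboolP[gl [D hD]]]; apply/asboolP; split.
- by move=> b x y; rewrite /= mulr0 addr0.
- by exists 0 => x; rewrite mul0r modulus0.
- move=> b x y; rewrite !fctE fl gl /= !scalerDr /GRing.scale /=.
  by rewrite mulrDr addrACA mulrCA.
- exists (modulus a * C + D) => x; rewrite !fctE.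
  apply: le_trans (modulusD _ _) _; rewrite mulrDl lerD// modulusM -mulrA.
  by rewrite ler_wpM2l ?modulus_ge0.
Qed.

HB.instance Definition _ :=
  GRing.isSubmodClosed.Build _ _ dual_pred dual_submod_closed.

Record dual := Dual { dual_fun :> E -> K^o; _ : dual_fun \in dual_pred }.
HB.instance Definition _ := [isSub of dual for dual_fun].
HB.instance Definition _ := [Choice of dual by <:].
HB.instance Definition _ := [SubChoice_isSubLmodule of dual by <:].

Definition dual_norm (f : dual) : R := opnorm f.

Definition dual_ball : set dual := [set f | dual_norm f <= 1].

Definition weak_lnorm (s : \bar R) (m : nat) (e : 'I_m -> E) : R :=
  sup [set lnorm s (fun i => modulus (f (e i))) | f in dual_ball].

Definition is_norm : Prop :=
  [/\ forall x y, N (x + y) <= N x + N y,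
      forall a x, N (a *: x) = modulus a * N x &
      forall x, N x = 0 -> x = 0].

End dual_space.
End dual.

Section tensor.
Context (R : realType) (k : scalar_kind).
Local Notation K := (scalars R k).

Section multilinear.
Context (I : finType) (X : I -> completeNormedModType K) (V : lmodType K).

Definition is_multilinear (T : (forall i, X i) -> V) : Prop :=
  forall (i : I) (x : forall i, X i), linear (fun t : X i => T (dfwith x i t)).

Definition multilinear_pred : {pred (forall i, X i) -> V} :=
  fun T => `[< is_multilinear T >].

Lemma multilinear_submod_closed : submod_closed multilinear_pred.
Proof.
split=> [|a f g /asboolP fl /asboolP gl]; apply/asboolP => i x b t u.
  by rewrite /= scaler0 addr0.
rewrite !fctE fl gl !scalerDr !scalerA (mulrC a b) -!addrA; congr (_ + _).
by rewrite addrCA.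
Qed.

HB.instance Definition _ :=
  GRing.isSubmodClosed.Build _ _ multilinear_pred multilinear_submod_closed.

Record multilinear := Multilinear {
  multilinear_fun :> (forall i, X i) -> V;
  _ : multilinear_fun \in multilinear_pred }.
HB.instance Definition _ := [isSub of multilinear for multilinear_fun].
HB.instance Definition _ := [Choice of multilinear by <:].
HB.instance Definition _ := [SubChoice_isSubLmodule of multilinear by <:].

End multilinear.

(* The algebraic tensor product, realized as the span, in the algebraic dual of
   the space of multilinear forms, of the evaluations at the points of the
   product of the X i. *)
Section tensor_product.
Context (I : finType) (X : I -> completeNormedModType K).

Definition form := multilinear X K^o.

Definition evaluation (x : forall i, X i) : form -> K^o := fun phi => phi x.

Definition tensor_pred : {pred form -> K^o} := fun u =>
  `[< exists m (l : 'I_m -> K) (x : 'I_m -> forall i, X i),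
        u = \sum_(j < m) l j *: evaluation (x j) >].

Lemma tensor_submod_closed : submod_closed tensor_pred.
Proof.
split.
  apply/asboolP; exists 0%N, (fun=> 0), (fun=> fun=> 0).
  by rewrite big_ord0.
move=> a u v /asboolP[m [l [x ->]]] /asboolP[n [r [y ->]]]; apply/asboolP.
exists (m + n)%N, (fun j : 'I_(m + n) => match fintype.split j with inl i => a * l i | inr i => r i end),
  (fun j : 'I_(m + n) => match fintype.split j with inl i => x i | inr i => y i end).
rewrite big_split_ord /= scaler_sumr; congr (_ + _); apply: eq_bigr => i _.
  by rewrite (unsplitK (inl i)) scalerA.
by rewrite (unsplitK (inr i)).
Qed.

HB.instance Definition _ :=
  GRing.isSubmodClosed.Build _ _ tensor_pred tensor_submod_closed.

Record tensor := Tensor {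
  tensor_fun : form -> K^o;
  _ : tensor_fun \in tensor_pred }.
HB.instance Definition _ := [isSub of tensor for tensor_fun].
HB.instance Definition _ := [Choice of tensor by <:].
HB.instance Definition _ := [SubChoice_isSubLmodule of tensor by <:].

Lemma evaluation_tensor x : evaluation x \in tensor_pred.
Proof.
apply/asboolP; exists 1%N, (fun=> 1), (fun=> x).
by rewrite big_ord1 scale1r.
Qed.

Definition tens (x : forall i, X i) : tensor := Tensor (evaluation_tensor x).

Definition Sigma : set tensor := range tens.

Definition linearization (phi : form) (u : tensor) : K := tensor_fun u phi.

Lemma linearization_tens phi x : linearization phi (tens x) = phi x.
Proof. by []. Qed.

Lemma linearization_scalar phi : scalar (linearization phi).
Proof. by []. Qed.

Lemma tensor_span (u : tensor) : exists m (l : 'I_m -> K) x,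
  u = \sum_(j < m) l j *: tens (x j).
Proof.
case: (u) => f uf; have /asboolP[m [l [x fE]]] := uf.
exists m, l, x; apply: val_inj; rewrite /= fE.
by elim/big_rec2: _ => //= j v w _ ->.
Qed.

Lemma prod_form_multilinear (f : forall i, dual (@vnorm R k (X i))) :
  (fun x : forall i, X i => \prod_i f i (x i) : K^o) \in @multilinear_pred I X K^o.
Proof.
apply/asboolP => i x a t u /=.
have h (w : X i) : \prod_j f j (dfwith x i w j) =
    f i w * \prod_(j | j != i) f j (x j).
  rewrite (bigD1 i) //= dfwithin; congr (_ * _).
  by apply: eq_bigr => j ji; rewrite dfwithout // eq_sym.
have /asboolP[fl _] := valP (f i).
by rewrite !h [f i _]fl mulrDl -mulrA.
Qed.

Definition prod_form (f : forall i, dual (@vnorm R k (X i))) : form :=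
  Multilinear (prod_form_multilinear f).

Definition injective_norm (u : tensor) : R :=
  sup [set modulus (linearization (prod_form f) u) |
        f in [set f : forall i, dual (@vnorm R k (X i)) |
               forall i, dual_ball (f i)]].

Definition projective_norm (u : tensor) : R :=
  inf [set c | exists m (x : 'I_m -> forall i, X i),
         u = \sum_(j < m) tens (x j) /\
         c = \sum_(j < m) \prod_i vnorm (x j i)].

Definition reasonable_crossnorm (beta : tensor -> R) : Prop :=
  is_norm beta /\
  forall u, injective_norm u <= beta u /\ beta u <= projective_norm u.

(* The closed unit ball of the space of multilinear forms with bounded
   linearization. *)
Definition form_ball (beta : tensor -> R) : set form :=
  [set phi | bounded_for beta (linearization phi) /\
             opnorm beta (linearization phi) <= 1].

Definition weak_diff_lnorm (beta : tensor -> R) (s : \bar R) (m : nat)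
    (a b : 'I_m -> tensor) : R :=
  sup [set lnorm s (fun i =>
             modulus (linearization phi (a i) - linearization phi (b i))) |
        phi in form_ball beta].

End tensor_product.

Section tensor_right.
Context (I : finType) (X : I -> completeNormedModType K).
Context (Y : completeNormedModType K).

(* The family X followed by Y, which sits at the index [None]. *)
Definition adjoin (o : option I) : completeNormedModType K :=
  if o is Some i then X i else Y.

Definition adjoin_pt (x : forall i, X i) (y : Y) : forall o, adjoin o :=
  fun o => match o with Some i => x i | None => y end.

Lemma partial_form_multilinear (psi : form adjoin) (y : Y) :
  (fun x => psi (adjoin_pt x y)) \in @multilinear_pred I X K^o.
Proof.
have /asboolP psil := valP psi.
apply/asboolP => i x a t u.
have h w : adjoin_pt (dfwith x i w) y =
    dfwith (T := adjoin) (adjoin_pt x y) (Some i) w.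
  apply: functional_extensionality_dep => -[j|] /=; last by rewrite dfwithout.
  have [<-|ij] := eqVneq i j.
    by rewrite dfwithin (@dfwithin _ adjoin _ (Some i)).
  by rewrite dfwithout // (@dfwithout _ adjoin _ (Some i) _ (Some j)).
by rewrite !h; exact: psil.
Qed.

Definition partial_form (psi : form adjoin) (y : Y) : form X :=
  Multilinear (partial_form_multilinear psi y).

Lemma tens_right_tensor (u : tensor X) (y : Y) :
  (fun psi => linearization (partial_form psi y) u) \in @tensor_pred _ adjoin.
Proof.
case: u => f uf; have /asboolP[m [l [x fE]]] := uf.
apply/asboolP; exists m, l, (fun j => adjoin_pt (x j) y).
by apply/funext => psi; rewrite /linearization /= fE !fct_sumE.
Qed.

(* u (x) y, for u in the tensor product of the X i. *)
Definition tens_right (u : tensor X) (y : Y) : tensor adjoin :=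
  Tensor (tens_right_tensor u y).

Lemma tens_right_tens x y : tens_right (tens x) y = tens (adjoin_pt x y).
Proof. by apply: val_inj. Qed.

Definition lapreste (beta : tensor X -> R) (s t : \bar R)
    (u : tensor adjoin) : R :=
  let rho := residual_exponent (hoelder_conjugate t) (hoelder_conjugate s) in
  inf [set c | exists m (l : 'I_m -> K) (a b : 'I_m -> tensor X) (y : 'I_m -> Y),
    [/\ forall i, Sigma (a i) /\ Sigma (b i),
        u = \sum_(i < m) l i *: tens_right (a i - b i) (y i) &
        c = lnorm rho (fun i => modulus (l i))
            * weak_diff_lnorm beta (hoelder_conjugate t) a b
            * weak_lnorm (@vnorm R k Y) (hoelder_conjugate s) y]].

End tensor_right.

Section dominated.
Context (I : finType) (X : I -> completeNormedModType K) (beta : tensor X -> R).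
Context (p q : \bar R).
Context (V : lmodType K) (N : V -> R).

Definition dominated_by (C : R) (T : (forall i, X i) -> V) : Prop :=
  forall m (x z : 'I_m -> forall i, X i) (v : 'I_m -> dual N),
    lnorm (hoelder_conjugate (residual_exponent p q))
      (fun i => modulus (v i (T (x i) - T (z i))))
    <= C * weak_diff_lnorm beta p (fun i => tens (x i)) (fun i => tens (z i))
         * weak_lnorm (@dual_norm R k V N) q v.

(* The side conditions on p and q are parameters only because they are used to
   show that the dominated operators form a vector space. *)
Definition dominated_pred (hp : (1 <= p)%E) (hq : (1 <= q)%E)
    (hpq : (p^-1 + q^-1 <= 1)%E) : {pred multilinear X V} :=
  fun T => `[< exists2 C : R, 0 < C & dominated_by C T >].

Context (hp : (1 <= p)%E) (hq : (1 <= q)%E) (hpq : (p^-1 + q^-1 <= 1)%E).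

Lemma dominated_submod_closed : submod_closed (dominated_pred hp hq hpq).
Proof.
have s0 := residual_conj_gt0 hp hq hpq.
have vl (v : dual N) : scalar v by case: v => f /= /asboolP[].
split=> [|a S T /asboolP[C C0 hC] /asboolP[D D0 hD]]; apply/asboolP.
  exists 1 => // m x z v; rewrite mul1r /=.
  rewrite (_ : (fun i => _) = (fun=> 0)) ?lnorm0 ?mulr_ge0 ?sup_set_ge0//.
  - by move=> _ [phi _ <-]; exact: lnorm_ge0.
  - by move=> _ [phi _ <-]; exact: lnorm_ge0.
  apply/funext => i; rewrite subr0.
  by have := vl (v i) (-1) 0 0; rewrite scaleN1r addNr mulN1r addNr => ->; rewrite modulus0.
have [c c0 hc] := lnorm_quasi s0.
exists (c * (modulus a * C + D)).
  by rewrite mulr_gt0 // ltr_wpDl // mulr_ge0 ?modulus_ge0 ?ltW.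
move=> m x z v.
pose f (U : multilinear X V) i := modulus (v i (U (x i) - U (z i))).
apply: (le_trans (hc (modulus a) m (f S) (f T) _ (modulus_ge0 a) _)).
  move=> i; rewrite !(ger0_norm (modulus_ge0 _)).
  rewrite (_ : _ - _ = a *: (S (x i) - S (z i)) + (T (x i) - T (z i))).
    rewrite vl; apply: le_trans (modulusD _ _) _.
    by rewrite modulusM.
  by rewrite /= !fctE scalerBr opprD addrACA.
rewrite -!mulrA ler_pM2l // mulrDl lerD //.
  by rewrite -mulrA ler_wpM2l ?modulus_ge0 // mulrA hC.
by rewrite mulrA hD.
Qed.

HB.instance Definition _ := GRing.isSubmodClosed.Build _ _
  (dominated_pred hp hq hpq) dominated_submod_closed.

Record dominated := Dominated {
  dominated_op :> multilinear X V;
  _ : dominated_op \in dominated_pred hp hq hpq }.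
HB.instance Definition _ := [isSub of dominated for dominated_op].
HB.instance Definition _ := [Choice of dominated by <:].
HB.instance Definition _ := [SubChoice_isSubLmodule of dominated by <:].

Definition dominated_norm (T : dominated) : R :=
  inf [set C | 0 < C /\ dominated_by C T].

End dominated.
End tensor.

(* Main.v *)
Require Import Defs.
From HB Require Import structures.
From mathcomp Require Import all_boot all_order all_algebra.
From mathcomp Require Import complex.
From mathcomp Require Import all_classical all_reals all_analysis.
From mathcomp Require Import ring lra.

Set Implicit Arguments.
Unset Strict Implicit.
Unset Printing Implicit Defensive.

Import Order.TTheory GRing.Theory Num.Theory.
Import numFieldNormedType.Exports.

Local Open Scope classical_set_scope.
Local Open Scope ring_scope.

(* If T is dominated, its functional is bounded by Hoelder's inequality applied
   to a representation of a tensor.  Conversely, a bounded functional controls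
   <T x - T z, y> only for y in Y, whereas domination tests against the bidual
   of Y.  The passage to the bidual is a weak form of local reflexivity: a
   finite net of the unit ball of the dual sequence space l_q*^m embeds Y^m with
   the weak q-norm, up to a factor tending to 1, into a finite l_oo-sum of
   copies of Y.  A functional on Y^m then extends by Hahn-Banach to that sum,
   where it is a tuple of elements of the dual of Y whose norms add up, so that
   it can be evaluated on sequences in the bidual. *)

(** * Scalars *)

Section scalars_theory.
Context (R : realType) (k : scalar_kind).
Local Notation K := (scalars R k).
Implicit Types (a b : K) (t s : R).

(** The weak q-norm of y in Y^m is the supremum of the norm of sum_i c_i y_i over c in the unit ball
    of l_q*^m. Restricting c to a finite net (c_j) makes the target a finite l_oo-sum, so that its
    functionals are finite tuples (psi_j). Extending y -> sum_i phi_i(y_i) along the embedding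
    amounts to writing phi_i = sum_j c_j(i) psi_j, where the norms of the psi_j add up to little
    more than the bound of the functional. For v_i in the bidual this gives sum_i v_i(phi_i) = sum_j
    (sum_i c_j(i) v_i)(psi_j), and each inner combination has norm at most the weak q-norm of v,
    because c_j lies in the ball. Thus it is the functionals phi_i that are decomposed; the v_i are
    never approximated by elements of Y. As the factor lost to the net tends to 1, the constant is
    preserved exactly, which is what the isometry requires. *)

Definition rscal (t : R) : scalars R k :=
  match k return scalars R k with
  | RealScalars => t
  | ComplexScalars => (t%:C)%C
  end.

Lemma rscalM t s : rscal (t * s) = rscal t * rscal s.
Proof. by rewrite /rscal; case: k => //; rewrite rmorphM. Qed.

Lemma rscal1 : rscal 1 = 1.
Proof. by rewrite /rscal; case: k. Qed.

Lemma rscal0 : rscal 0 = 0.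
Proof. by rewrite /rscal; case: k. Qed.

Lemma rscalD t s : rscal (t + s) = rscal t + rscal s.
Proof. by rewrite /rscal; case: k => //; rewrite rmorphD. Qed.

Lemma rscalN t : rscal (- t) = - rscal t.
Proof. by rewrite /rscal; case: k => //; rewrite rmorphN. Qed.

Lemma realvalD a b : realval (a + b) = realval a + realval b.
Proof. by move: a b; case: k => //= -[? ?] [? ?]. Qed.

Lemma realvalN a : realval (- a) = - realval a.
Proof. by move: a; case: k => //= -[? ?]. Qed.

Lemma realvalM t a : realval (rscal t * a) = t * realval a.
Proof.
by move: a; rewrite /rscal; case: k => //= -[? ?] /=; rewrite mul0r subr0.
Qed.

Lemma realval0 : realval (0 : K) = 0.
Proof. by case: k. Qed.

Lemma realval_rscal t : realval (rscal t) = t.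
Proof. by rewrite -[rscal t]mulr1 realvalM; case: k; rewrite /= mulr1. Qed.

Lemma realval_sum (J : Type) (r : seq J) (P : pred J) (F : J -> K) :
  realval (\sum_(j <- r | P j) F j) = \sum_(j <- r | P j) realval (F j).
Proof.
by elim/big_rec2: _ => [|j x y _ <-]; rewrite ?realval0 // realvalD.
Qed.

Lemma realval_norm_ge0 (x : K) : 0 <= x -> 0 <= realval x.
Proof. by move: x; case: k => //= x; rewrite lecE => /andP[]. Qed.

Lemma normr_modulus a : `|a| = rscal (modulus a).
Proof.
rewrite /modulus /rscal; by move: a; case: k => //= a.
Qed.

Lemma modulus_rscal t : modulus (rscal t) = `|t|.
Proof.
rewrite /modulus /rscal; case: k => //=.
by rewrite expr0n /= addr0 sqrtr_sqr.
Qed.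

Lemma modulus1 : modulus (1 : K) = 1.
Proof. by rewrite -rscal1 modulus_rscal normr1. Qed.

Lemma modulusN a : modulus (- a) = modulus a.
Proof. by rewrite /modulus normrN. Qed.

Lemma modulus_eq0 a : modulus a = 0 -> a = 0.
Proof.
move=> a0; apply/eqP; rewrite -normr_eq0 normr_modulus a0.
by rewrite /rscal; case: k.
Qed.

Lemma modulus_sum (J : Type) (r : seq J) (P : pred J) (F : J -> K) :
  modulus (\sum_(j <- r | P j) F j) <= \sum_(j <- r | P j) modulus (F j).
Proof.
elim/big_rec2: _ => [|j x y _ h]; first by rewrite modulus0.
by apply: le_trans (modulusD _ _) _; rewrite lerD2l.
Qed.

Lemma realval_le_modulus a : realval a <= modulus a.
Proof.
rewrite /modulus; move: a; case: k => /= a; first exact: ler_norm.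
case: a => x y /=; rewrite (le_trans (ler_norm x))// -sqrtr_sqr ler_wsqrtr//.
by rewrite lerDl sqr_ge0.
Qed.

Lemma unimodular_rotation a :
  exists2 c : K, modulus c = 1 & c * a = rscal (modulus a).
Proof.
have [->|a0] := eqVneq a 0.
  by exists 1; rewrite ?modulus1// mulr0 modulus0 /rscal; case: k.
exists (`|a| / a); last by rewrite divfK// normr_modulus.
have: modulus (`|a| / a) * modulus a = modulus a.
  by rewrite -modulusM divfK// /modulus normr_id.
have ma0 : modulus a != 0 by apply: contra_neq a0; exact: modulus_eq0.
by move=> h; apply: (mulIf ma0); rewrite h mul1r.
Qed.

(** A unimodular factor turns [a] into its modulus, which is its own real part. Real estimates, such
    as those from the real Hahn-Banach theorem, thereby bound moduli over both fields. *)
Lemma modulus_le_of_realval a (A : R) :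
  (forall c : K, modulus c = 1 -> realval (c * a) <= A) -> modulus a <= A.
Proof.
move=> h; have [c c1 ca] := unimodular_rotation a.
by have := h c c1; rewrite ca realval_rscal.
Qed.

(** Total boundedness of the disc as a finite colouring instead of a finite set of centres: tuples
    of colours then colour m-dimensional balls, and representatives can be chosen inside the ball of
    any l_s norm. *)
Lemma unit_disc_cells (d : R) : 0 < d ->
  exists (J : finType) (cell : K -> J), forall a b,
    modulus a <= 1 -> modulus b <= 1 -> cell a = cell b -> modulus (a - b) <= d.
Proof.
(* The interval [-1, 1] is cut into pieces of length [d / 2]. For [t <= 1] the index is at most the
   integer part of [4 / d], so [inord] does not alter it. *)
move=> d0; pose N := (Num.trunc (4 / d)).+1.
pose c1 (t : R) : 'I_N := inord (Num.trunc (2 * (t + 1) / d)).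
have cellP t s : -1 <= t <= 1 -> -1 <= s <= 1 -> c1 t = c1 s -> `|t - s| <= d / 2.
  move=> /andP[t1 t2] /andP[s1 s2].
  have bnd u : -1 <= u -> u <= 1 -> 0 <= 2 * (u + 1) / d.
    by move=> u1 u2; apply: divr_ge0; [lra | exact: ltW].
  have trN u : -1 <= u -> u <= 1 -> (Num.trunc (2 * (u + 1) / d)%R < N)%N.
    move=> u1 u2; rewrite ltnS; apply: le_truncn.
    by rewrite ler_pM2r ?invr_gt0//; lra.
  move=> /(congr1 val); rewrite /= !inordK ?trN// => ets.
  have /andP[lt1 lt2] := trunc_itv (bnd _ t1 t2).
  have /andP[ls1 ls2] := trunc_itv (bnd _ s1 s2).
  rewrite ets in lt1 lt2.
  rewrite -[X in _ < X]natr1 in lt2; rewrite -[X in _ < X]natr1 in ls2.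
  move: lt1 lt2 ls1 ls2.
  move: (Num.trunc _)%:R => n lt1 lt2 ls1 ls2.
  rewrite ler_pdivlMr // in lt1; rewrite ltr_pdivrMr // in lt2.
  rewrite ler_pdivlMr // in ls1; rewrite ltr_pdivrMr // in ls2.
  by rewrite ler_norml; apply/andP; split; lra.
rewrite /modulus; case: k => /=.
  exists 'I_N, c1; move=> a b ha hb ab.
  by apply: le_trans (cellP a b _ _ ab) _; rewrite -?ler_norml//; lra.
(* The cells are squares of side [d / 2], whose diagonal is shorter than [d]. *)
exists ('I_N * 'I_N)%type, (fun z => (c1 (complex.Re z), c1 (complex.Im z))).
move=> [a1 a2] [b1 b2] /= ha hb [e1 e2].
have half (x y : R) : Num.sqrt (x ^+ 2 + y ^+ 2) <= 1 ->
    -1 <= x <= 1 /\ -1 <= y <= 1.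
  move=> h; rewrite -!ler_norml -!sqrtr_sqr.
  by split; apply: le_trans h; rewrite ler_wsqrtr// ?lerDl ?lerDr sqr_ge0.
have [ha1 ha2] := half _ _ ha; have [hb1 hb2] := half _ _ hb.
have := cellP _ _ ha1 hb1 e1; have := cellP _ _ ha2 hb2 e2.
rewrite !ler_norml => /andP[u1 u2] /andP[w1 w2].
rewrite -(ger0_norm (ltW d0)) -sqrtr_sqr ler_wsqrtr//.
have : (a1 - b1) ^+ 2 <= (d / 2) ^+ 2 by rewrite !expr2; nra.
have : (a2 - b2) ^+ 2 <= (d / 2) ^+ 2 by rewrite !expr2; nra.
have : (d / 2) ^+ 2 + (d / 2) ^+ 2 <= d ^+ 2 by rewrite !expr2; nra.
lra.
Qed.

End scalars_theory.

Section vnorm_theory.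
Context (R : realType) (k : scalar_kind) (E : normedModType (scalars R k)).
Implicit Types x y : E.

Lemma vnormZ a x : vnorm (a *: x) = modulus a * vnorm x.
Proof. by rewrite /vnorm normrZ normr_modulus realvalM. Qed.

Lemma vnormD x y : vnorm (x + y) <= vnorm x + vnorm y.
Proof.
rewrite /vnorm -realvalD -subr_ge0 -realvalN -realvalD.
by apply: realval_norm_ge0; rewrite subr_ge0 ler_normD.
Qed.

End vnorm_theory.

Section scalar_functions.
Context (K : pzRingType) (E : lmodType K) (f : E -> K) (f_scalar : scalar f).

Lemma scalar_fun0 : f 0 = 0.
Proof.
by have := f_scalar (-1) 0 0; rewrite scaler0 addr0 mulN1r addNr.
Qed.

Lemma scalar_funZ a x : f (a *: x) = a * f x.
Proof. by have := f_scalar a x 0; rewrite scalar_fun0 !addr0. Qed.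

Lemma scalar_funD x y : f (x + y) = f x + f y.
Proof. by have := f_scalar 1 x y; rewrite scale1r mul1r. Qed.

End scalar_functions.

(** * Duality of finite sequence spaces *)

Section lnorm_duality.
Context (R : realType).
Implicit Types s : \bar R.

Lemma hoelder_conjugate_cases s : (1 <= s)%E ->
  [\/ s = 1%E /\ hoelder_conjugate s = +oo%E,
      s = +oo%E /\ hoelder_conjugate s = 1%E |
      exists x y : R, [/\ s = x%:E, hoelder_conjugate s = y%:E,
                          0 < x, 0 < y & x^-1 + y^-1 = 1]].
Proof.
move=> s1; have [->|n1] := eqVneq s 1%E.
  by constructor 1; rewrite hoelder_conjugate1.
have [->|ny] := eqVneq s +oo%E.
  by constructor 2; rewrite hoelder_conjugatey.
have t1 := hoelder_conj_ge1 s1.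
have s0 : s != 0%E by apply: contraTneq s1 => ->; rewrite lee_fin ler10.
have sum1 := hoelder_conjugate_eq1 (lt_le_trans (ltNyr 1) s1) s0.
have ty : hoelder_conjugate s != +oo%E.
  by apply: contra_neq n1; exact: hoelder_conjugate_eqy.
constructor 3; move: s1 t1 ny ty sum1 {n1 s0}.
case: s => // x; case: hoelder_conjugate => // y.
rewrite !lee_fin => x1 y1 _ _.
have x0 : 0 < x by exact: lt_le_trans x1.
have y0 : 0 < y by exact: lt_le_trans y1.
by rewrite !inver !gt_eqF// -EFinD => -[h]; exists x, y.
Qed.

Lemma powRV (z u : R) : 0 <= z -> z^-1 `^ u = (z `^ u)^-1.
Proof. by move=> z0; rewrite -powR_inv1// -powRrM mulN1r powRN. Qed.

Lemma lnorm1 m (a : 'I_m -> R) : lnorm 1 a = \sum_i `|a i|.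
Proof.
rewrite /lnorm/= invr1 (eq_bigr (fun i => `|a i|)) => [|i _]; rewrite powRr1//.
exact: sumr_ge0.
Qed.

Lemma lnorm_powR (x : R) m (a : 'I_m -> R) : 0 < x ->
  lnorm x%:E a `^ x = \sum_i `|a i| `^ x.
Proof.
move=> x0; rewrite /lnorm -powRrM mulVf ?gt_eqF// powRr1//.
by apply: sumr_ge0 => i _; exact: powR_ge0.
Qed.

Lemma ler_norm_lnorm s m (a : 'I_m -> R) i : (1 <= s)%E -> `|a i| <= lnorm s a.
Proof.
case: s => [x| |] //; last by move=> _; exact: le_bigmax.
rewrite lee_fin => x1; have x0 : 0 < x by exact: lt_le_trans x1.
rewrite -[leLHS]powRr1// -(@mulfV _ x) ?gt_eqF// powRrM /lnorm.
apply: ge0_ler_powR; rewrite ?nnegrE ?invr_ge0 ?powR_ge0 ?(ltW x0)//.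
  by apply: sumr_ge0 => j _; exact: powR_ge0.
by rewrite (bigD1 i)//= lerDl sumr_ge0// => j _; exact: powR_ge0.
Qed.

Lemma lnormZ s m (t : R) (a : 'I_m -> R) : (1 <= s)%E -> 0 <= t ->
  lnorm s (fun i => t * a i) = t * lnorm s a.
Proof.
case: s => [x| |] //.
  rewrite lee_fin => x1 t0; have x0 : 0 < x by exact: lt_le_trans x1.
  rewrite /lnorm -[t in RHS]powRr1// -(@mulfV _ x) ?gt_eqF// powRrM.
  rewrite -powRM ?powR_ge0//.
    rewrite mulr_sumr; congr (_ `^ _); apply: eq_bigr => i _.
    by rewrite normrM ger0_norm// powRM.
  by apply: sumr_ge0 => i _; exact: powR_ge0.
move=> _ t0; rewrite /lnorm.
elim/big_rec2: _ => [|i y z _ ->]; first by rewrite mulr0.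
by rewrite normrM (ger0_norm t0) maxr_pMr.
Qed.

Lemma hoelder_lnorm s m (a b : 'I_m -> R) : (1 <= s)%E ->
  \sum_i `|a i| * `|b i| <= lnorm s a * lnorm (hoelder_conjugate s) b.
Proof.
move=> s1; have t1 := hoelder_conj_ge1 s1.
have one_max (c d : 'I_m -> R) :
    \sum_i `|c i| * `|d i| <= lnorm 1 c * lnorm +oo%E d.
  rewrite lnorm1 mulr_suml; apply: ler_sum => i _.
  by rewrite ler_wpM2l//; apply: ler_norm_lnorm; rewrite leey.
have [[-> ->]|[-> ->]|[x [y [sx ty x0 y0 xy]]]] := hoelder_conjugate_cases s1.
- exact: one_max.
- rewrite mulrC; under eq_bigr do rewrite mulrC; exact: one_max.
set A := lnorm s a; set B := lnorm _ b.
have [A0|A0] := eqVneq A 0.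
  rewrite A0 mul0r big1// => i _; have := ler_norm_lnorm a i s1.
  by rewrite -/A A0 normr_le0 => /eqP ->; rewrite normr0 mul0r.
have [B0|B0] := eqVneq B 0.
  rewrite B0 mulr0 big1// => i _; have := ler_norm_lnorm b i t1.
  by rewrite -/B B0 normr_le0 => /eqP ->; rewrite normr0 mulr0.
have {}A0 : 0 < A by rewrite lt_def A0 lnorm_ge0.
have {}B0 : 0 < B by rewrite lt_def B0 lnorm_ge0.
have AE : A `^ x = \sum_i `|a i| `^ x by rewrite /A sx lnorm_powR.
have BE : B `^ y = \sum_i `|b i| `^ y by rewrite /B ty lnorm_powR.
(* After normalization by [A] and [B], Young's inequality applies termwise, and its right-hand sides
   add up to 1/x + 1/y = 1. *)
rewrite -[A * B]mulr1 -ler_pdivrMl ?mulr_gt0// mulr_sumr.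
apply: (@le_trans _ _ (\sum_i ((`|a i| `^ x / A `^ x) / x +
    (`|b i| `^ y / B `^ y) / y))).
  apply: ler_sum => i _.
  have -> : (A * B)^-1 * (`|a i| * `|b i|) = (`|a i| / A) * (`|b i| / B).
    by rewrite invfM; ring.
  apply: le_trans (@conjugate_powR _ _ _ x y _ _ x0 y0 xy) _.
  - by rewrite divr_ge0// ltW.
  - by rewrite divr_ge0// ltW.
  by rewrite !powRM ?invr_ge0 ?(ltW A0) ?(ltW B0)// !powRV ?(ltW A0) ?(ltW B0).
rewrite big_split/= -!mulr_suml -AE -BE !divff ?gt_eqF ?powR_gt0//.
by rewrite !mul1r xy.
Qed.

(** Equality case of Hoelder's inequality: the constant 1 for s = 1, the indicator of a maximal
    entry for s = +oo, and otherwise the normalized powers a_i^(x-1). *)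
Lemma lnorm_attained s m (a : 'I_m -> R) : (1 <= s)%E -> (forall i, 0 <= a i) ->
  exists b : 'I_m -> R, [/\ forall i, 0 <= b i,
    lnorm (hoelder_conjugate s) b <= 1 & lnorm s a = \sum_i b i * a i].
Proof.
move=> s1 a0.
(* The zero case includes m = 0, where no entry is maximal, and excludes a zero denominator in the
   general formula. *)
have [->|na0] := eqVneq (lnorm s a) 0.
  exists (fun=> 0); split => //.
    by rewrite lnorm0// (lt_le_trans lte01)//; exact: hoelder_conj_ge1.
  by rewrite big1// => i _; rewrite mul0r.
have [[-> ->]|[sy ->]|[x [y [sx ty x0 y0 xy]]]] := hoelder_conjugate_cases s1.
- exists (fun=> 1); split => //.
    by apply: bigmax_le => // i _; rewrite normr1.
  by rewrite lnorm1; apply: eq_bigr => i _; rewrite mul1r ger0_norm.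
- rewrite sy; have [i imax] : exists i, a i = lnorm +oo%E a.
    have : lnorm +oo%E a = 0 \/ exists i, a i = lnorm +oo%E a.
      rewrite /lnorm; elim/big_ind: _ => [|u v hu hv|i _]; first by left.
        by rewrite /Num.max; case: ifP.
      by right; exists i; rewrite ger0_norm.
    by case=> // ay0; move: na0; rewrite sy ay0 eqxx.
  exists (fun j => (j == i)%:R); split => //.
    rewrite lnorm1 (bigD1 i)//= eqxx normr1 big1 ?addr0// => j /negPf ->.
    by rewrite normr0.
  rewrite -imax (bigD1 i)//= eqxx mul1r big1 ?addr0// => j /negPf ->.
  by rewrite mul0r.
pose S := \sum_i a i `^ x.
have S0 : 0 <= S by apply: sumr_ge0 => i _; exact: powR_ge0.
have aE : lnorm s a = S `^ x^-1.
  by rewrite sx /lnorm; congr (_ `^ _); apply: eq_bigr => i _; rewrite ger0_norm.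
have {na0} S1 : 0 < S.
  rewrite lt_def S0 andbT; apply: contra_neq na0; rewrite aE => ->.
  by rewrite powR0// invr_eq0 gt_eqF.
(* Since (x - 1) y = x, the y-norm of the powers is S^(1/y), whence the denominator; the pairing
   with [a] is S / S^(1/y) = S^(1/x). *)
exists (fun i => a i `^ (x - 1) / S `^ y^-1); split => [i||].
- by rewrite divr_ge0 ?powR_ge0.
- have xy1 : (x - 1) * y = x.
    have : y * x * (x^-1 + y^-1) = y * x by rewrite xy mulr1.
    rewrite mulrDr -mulrA divff ?gt_eqF// [y * x]mulrC -mulrA divff ?gt_eqF//.
    by move=> h; rewrite mulrBl mul1r; lra.
  rewrite ty /lnorm.
  rewrite (eq_bigr (fun i => a i `^ x / S)) => [|i _].
    by rewrite -mulr_suml divff ?gt_eqF// powR1.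
  rewrite ger0_norm ?divr_ge0 ?powR_ge0// powRM ?invr_ge0 ?powR_ge0//.
  rewrite -powRrM xy1; congr (_ * _).
  by rewrite powRV ?powR_ge0// -powRrM mulVf ?gt_eqF// powRr1.
rewrite aE [RHS](eq_bigr (fun i => a i `^ x / S `^ y^-1)) => [|i _].
  rewrite -mulr_suml -/S -[S in S / _]powRr1// -powRB ?(gt_eqF S1) ?implybT//.
  by congr (_ `^ _); lra.
by rewrite mulrAC [_ * a i]mulrC mulr_powRB1.
Qed.

(** The extremal [b] has entries at most 1. This crude bound shows that the sets under the suprema
    in weak norms are bounded, which matters because [sup] of an unbounded set is 0. *)
Lemma lnorm_le_sum s m (a : 'I_m -> R) : (1 <= s)%E ->
  (forall i, 0 <= a i) -> lnorm s a <= \sum_i a i.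
Proof.
move=> s1 a0; have [b [b0 b1 ->]] := lnorm_attained s1 a0.
apply: ler_sum => i _; rewrite ler_piMl//.
rewrite -[b i]ger0_norm// (le_trans _ b1)// ler_norm_lnorm//.
exact: hoelder_conj_ge1.
Qed.

End lnorm_duality.

Section scalar_lnorm_duality.
Context (R : realType) (k : scalar_kind).
Local Notation K := (scalars R k).

Lemma hoelder_modulus (s : \bar R) m (a b : 'I_m -> K) : (1 <= s)%E ->
  modulus (\sum_i a i * b i) <=
    lnorm s (fun i => modulus (a i)) *
    lnorm (hoelder_conjugate s) (fun i => modulus (b i)).
Proof.
move=> s1; apply: le_trans (hoelder_lnorm _ _ s1).
apply: le_trans (modulus_sum _ _ _) _; apply: ler_sum => i _.
by rewrite modulusM !ger0_norm ?modulus_ge0.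
Qed.

(** The test coefficients are the extremal weights times phases that turn each [a i] into its
    modulus; the pairing is then the norm itself. *)
Lemma lnorm_le_of_pairing (s : \bar R) m (a : 'I_m -> K) (A : R) : (1 <= s)%E ->
  (forall c : 'I_m -> K,
    lnorm (hoelder_conjugate s) (fun i => modulus (c i)) <= 1 ->
    modulus (\sum_i c i * a i) <= A) ->
  lnorm s (fun i => modulus (a i)) <= A.
Proof.
move=> s1 h.
have [b [b0 b1 ->]] :=
  @lnorm_attained _ s m (fun i => modulus (a i)) s1 (fun i => modulus_ge0 _).
have /choice[c cP] i : exists c : K,
    modulus c = 1 /\ c * a i = rscal k (modulus (a i)).
  by have [c] := unimodular_rotation (a i); exists c.
rewrite (_ : \sum_i _ = realval (\sum_i (rscal k (b i) * c i) * a i)).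
  apply: le_trans (realval_le_modulus _) (h _ _).
  rewrite (_ : (fun i => _) = b)//; apply/funext => i.
  by rewrite modulusM (cP i).1 mulr1 modulus_rscal ger0_norm.
rewrite realval_sum; apply: eq_bigr => i _.
by rewrite -mulrA (cP i).2 realvalM realval_rscal.
Qed.

End scalar_lnorm_duality.

(** * Duals and weak norms *)

Section dual_theory.
Context (R : realType) (k : scalar_kind).
Local Notation K := (scalars R k).

(** Shared by seminorms, dual norms and the Lapreste norm, so that the bound of [f x] by the norm of
    [f] times [N x] is proved once for all of them. *)
Definition pos_homogeneous (E : lmodType K) (N : E -> R) :=
  (forall x, 0 <= N x) /\
  (forall t x, 0 < t -> N (rscal k t *: x) <= t * N x).

Section single_space.
Context (E : lmodType K) (N : E -> R).
Implicit Types f : dual N.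

Lemma dual_scalar f : scalar f.
Proof. by have /asboolP[] := valP f. Qed.

Lemma dual_bounded f : bounded_for N f.
Proof. by have /asboolP[] := valP f. Qed.

Lemma dual_of_bound (f : E -> K^o) (C : R) : scalar f ->
  (forall x, modulus (f x) <= C * N x) -> f \in dual_pred N.
Proof. by move=> fl fC; apply/asboolP; split => //; exists C. Qed.

Lemma dual_sum (J : finType) (F : J -> dual N) x :
  (\sum_j F j) x = \sum_j F j x.
Proof. by elim/big_rec2: _ => //= j u v _ <-. Qed.

Lemma opnorm_ge0 (f : E -> K) : 0 <= opnorm N f.
Proof. by apply: sup_set_ge0 => _ [x _ <-]; exact: modulus_ge0. Qed.

Lemma opnorm_le (f : E -> K) (C : R) : 0 <= C ->
  (forall x, modulus (f x) <= C * N x) -> opnorm N f <= C.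
Proof.
move=> C0 fC; rewrite /opnorm; set A := [set _ | _ in _].
have [A0|/set0P/negP/negPn/eqP ->] := pselect (A !=set0); last by rewrite sup0.
apply: ge_sup A0 _ => _ [x /= Nx <-].
by apply: le_trans (fC x) _; rewrite ler_piMr.
Qed.

Context (N_hom : pos_homogeneous N).

Lemma modulus_le_opnorm (f : E -> K) x : scalar f -> bounded_for N f ->
  modulus (f x) <= opnorm N f * N x.
Proof.
move=> fl [C fC]; have [N0 Nt] := N_hom.
(* Such an [x] cannot be rescaled to norm one, but boundedness already forces [f x] to vanish. *)
have [Nx|Nx] := eqVneq (N x) 0.
  by have := fC x; rewrite Nx !mulr0.
have {}Nx : 0 < N x by rewrite lt_def Nx N0.
have fZ t : modulus (f (rscal k t *: x)) = `|t| * modulus (f x).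
  rewrite -(modulus_rscal k t) -modulusM.
  by rewrite (scalar_funZ fl).
rewrite -ler_pdivrMr//.
apply: (@le_trans _ _ (modulus (f (rscal k (N x)^-1 *: x)))).
  by rewrite fZ ger0_norm ?invr_ge0// mulrC.
apply: ub_le_sup.
  (* The constant in [bounded_for] may be negative, hence the absolute value. *)
  exists `|C| => _ [y /= Ny <-]; apply: le_trans (fC y) _.
  by apply: le_trans (ler_wpM2r (N0 y) (ler_norm C)) _; rewrite ler_piMr.
exists (rscal k (N x)^-1 *: x) => //=.
by apply: le_trans (Nt _ _ _) _; rewrite ?invr_gt0// mulVf// gt_eqF.
Qed.

Lemma modulus_dual_le f x : modulus (f x) <= dual_norm f * N x.
Proof. exact: modulus_le_opnorm (dual_scalar f) (dual_bounded f). Qed.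

Lemma modulus_dual_ball f x : dual_ball f -> modulus (f x) <= N x.
Proof.
move=> /= f1; apply: le_trans (modulus_dual_le f x) _.
by rewrite ler_piMl// N_hom.1.
Qed.

Lemma dual_norm_homogeneous : pos_homogeneous (@dual_norm _ _ _ N).
Proof.
split=> [f|t f t0]; first exact: opnorm_ge0.
apply: opnorm_le => [|x]; first by rewrite mulr_ge0 ?opnorm_ge0 ?ltW.
rewrite -mulrA; have -> : (rscal k t *: f) x = rscal k t * f x by [].
by rewrite modulusM modulus_rscal gtr0_norm// ler_pM2l// modulus_dual_le.
Qed.

End single_space.

Lemma bidual_embedding_subproof (E : lmodType K) (N : E -> R)
    (N_hom : pos_homogeneous N) x :
  (fun f : dual N => f x : K^o) \in dual_pred (@dual_norm R k E N).
Proof.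
apply: (@dual_of_bound _ _ _ (N x)) => // f.
by rewrite mulrC; exact: modulus_dual_le.
Qed.

Definition bidual_embedding (E : lmodType K) (N : E -> R)
    (N_hom : pos_homogeneous N) (x : E) : dual (@dual_norm R k E N) :=
  Dual (bidual_embedding_subproof N_hom x).

Lemma bidual_embedding_le (E : lmodType K) (N : E -> R)
    (N_hom : pos_homogeneous N) x : dual_norm (bidual_embedding N_hom x) <= N x.
Proof.
apply: opnorm_le => [|f]; first exact: N_hom.1.
by rewrite mulrC; exact: (modulus_dual_le N_hom f x).
Qed.

Section weak_norm.
Context (E : lmodType K) (N : E -> R) (N_hom : pos_homogeneous N).
Context (s : \bar R) (s1 : (1 <= s)%E) (m : nat).
Implicit Types e : 'I_m -> E.

Lemma lnorm_le_weak e (f : dual N) : dual_ball f ->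
  lnorm s (fun i => modulus (f (e i))) <= weak_lnorm N s e.
Proof.
move=> f1; apply: ub_le_sup; last by exists f.
exists (\sum_i N (e i)) => _ [g g1 <-].
apply: (le_trans (lnorm_le_sum s1 _)) => [i|]; first exact: modulus_ge0.
by apply: ler_sum => i _; exact: modulus_dual_ball.
Qed.

Lemma weak_lnorm_ge0 e : 0 <= weak_lnorm N s e.
Proof. by apply: sup_set_ge0 => _ [f _ <-]; exact: lnorm_ge0. Qed.

Lemma dual_ball0 : dual_ball (0 : dual N).
Proof.
rewrite /dual_ball/= (le_trans (opnorm_le (lexx 0) _))// => x.
by rewrite mul0r modulus0.
Qed.

Lemma weak_lnorm_le e (C : R) :
  (forall f : dual N, dual_ball f -> lnorm s (fun i => modulus (f (e i))) <= C) ->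
  weak_lnorm N s e <= C.
Proof.
move=> h; apply: ge_sup => [|_ [f f1 <-]]; last exact: h.
exists (lnorm s (fun i => modulus ((0 : dual N) (e i)))), 0 => //.
exact: dual_ball0.
Qed.

Lemma weak_lnorm_le_sum e : weak_lnorm N s e <= \sum_i N (e i).
Proof.
apply: weak_lnorm_le => f f1.
apply: (le_trans (lnorm_le_sum s1 _)) => [i|]; first exact: modulus_ge0.
by apply: ler_sum => i _; exact: modulus_dual_ball.
Qed.

End weak_norm.

(** A functional in the ball of the third dual, composed with the embedding, lies in the ball of the
    dual of [E]; so the bidual brings no larger test values. *)
Lemma weak_lnorm_bidual_embedding (E : lmodType K) (N : E -> R)
    (N_hom : pos_homogeneous N) (s : \bar R) m (e : 'I_m -> E) : (1 <= s)%E ->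
  weak_lnorm (@dual_norm R k _ (@dual_norm R k E N)) s
    (fun i => bidual_embedding N_hom (e i)) <= weak_lnorm N s e.
Proof.
move=> s1; apply: weak_lnorm_le => F F1.
have bidual_hom := dual_norm_homogeneous (dual_norm_homogeneous N_hom).
have Fb x : modulus (F (bidual_embedding N_hom x)) <= 1 * N x.
  rewrite mul1r.
  exact: le_trans (modulus_dual_ball bidual_hom _ F1) (bidual_embedding_le _ _).
have Fl : scalar (fun x => F (bidual_embedding N_hom x) : K^o).
  move=> a x y; rewrite -(dual_scalar F); congr (F _).
  by apply: val_inj; apply/funext => f; exact: (dual_scalar f).
have := lnorm_le_weak N_hom s1 e (f := Dual (dual_of_bound Fl Fb)).
by apply; apply: opnorm_le Fb.
Qed.

End dual_theory.

(** * The Hahn-Banach theorem *)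

Section sublinear_theory.
Context (R : realType) (k : scalar_kind).
Local Notation K := (scalars R k).

Definition sublinear (W : lmodType K) (p : W -> R) :=
  (forall x y, p (x + y) <= p x + p y) /\
  (forall t x, 0 <= t -> p (rscal k t *: x) = t * p x).

Definition seminorm (W : lmodType K) (p : W -> R) :=
  (forall x y, p (x + y) <= p x + p y) /\
  (forall a x, p (a *: x) = modulus a * p x).

Section hahn_banach.
Context (W : lmodType K).
Implicit Types p q : W -> R.

Lemma sublinear0 p : sublinear p -> p 0 = 0.
Proof. by move=> [_ /(_ 0 0 (lexx 0))]; rewrite rscal0 scale0r mul0r. Qed.

Lemma sublinear_oppr p x : sublinear p -> - p (- x) <= p x.
Proof.
move=> ps; rewrite -subr_ge0 opprK -(sublinear0 ps) -(addrN x).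
exact: ps.1.
Qed.

(* Both steps of the Hahn-Banach theorem, prescribing values along a linear map
   and showing that a minimal sublinear functional is additive, lower p in this
   way for a suitable convex cone C. *)
Lemma sublinear_lower p (C : W -> R -> Prop) : sublinear p ->
  C 0 0 ->
  (forall c d r s, C c r -> C d s -> C (c + d) (r + s)) ->
  (forall t c r, 0 <= t -> C c r -> C (rscal k t *: c) (t * r)) ->
  (forall c r, C c r -> r <= p c) ->
  exists q, [/\ sublinear q, forall w, q w <= p w &
                forall c r, C c r -> q (- c) <= - r].
Proof.
move=> ps C0 CD CZ Cp.
(* The infimum of [S w] is finite because r <= p c <= p (w + c) + p (- w). Taking c = 0 shows q <=
   p, and taking w = - c gives the prescribed inequality. *)
pose S w := [set z | exists c r, C c r /\ z = p (w + c) - r].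
have S0 w : S w !=set0 by exists (p (w + 0) - 0), 0, 0.
have Slb w : has_lbound (S w).
  exists (- p (- w)) => _ [c [r [Ccr ->]]].
  have := ps.1 (w + c) (- w); rewrite addrAC addrN add0r.
  by have := Cp _ _ Ccr; lra.
pose q w := inf (S w).
have qle w c r : C c r -> q w <= p (w + c) - r.
  by move=> Ccr; apply: ge_inf => //; exists c, r.
have leq w z : (forall c r, C c r -> z <= p (w + c) - r) -> z <= q w.
  by move=> h; apply: lb_le_inf => // _ [c [r [Ccr ->]]]; exact: h.
exists q; split.
- split=> [x y|t x].
    suff h c r : C c r -> q (x + y) - q y <= p (x + c) - r.
      by rewrite -lerBlDr; exact: leq.
    move=> Ccr; rewrite lerBlDr [leRHS]addrC -lerBlDr.
    apply: leq => d s Cds.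
    have := qle (x + y) _ _ (CD _ _ _ _ Ccr Cds); rewrite addrACA.
    by have := ps.1 (x + c) (y + d); lra.
  have le u y : 0 < u -> q (rscal k u *: y) <= u * q y.
    move=> u0; rewrite -ler_pdivrMl//; apply: leq => c r Ccr.
    rewrite ler_pdivrMl// mulrBr -ps.2 ?(ltW u0)// scalerDr.
    by apply: qle; apply: CZ => //; exact: ltW.
  rewrite le_eqVlt => /predU1P[<-|t0].
    rewrite rscal0 scale0r mul0r; apply/eqP; rewrite eq_le; apply/andP; split.
      by have := qle 0 _ _ C0; rewrite addr0 subr0 (sublinear0 ps).
    by apply: leq => c r /Cp; rewrite add0r subr_ge0.
  apply/eqP; rewrite eq_le le//=.
  have := le t^-1 (rscal k t *: x); rewrite invr_gt0 => /(_ t0).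
  by rewrite scalerA -rscalM mulVf ?gt_eqF// rscal1 scale1r ler_pdivlMl.
- by move=> w; have := qle w _ _ C0; rewrite addr0 subr0.
- move=> c r Ccr; have := qle (- c) _ _ Ccr.
  by rewrite addNr (sublinear0 ps) sub0r.
Qed.

(** Zorn's lemma for the reversed pointwise order. A chain is bounded by its pointwise infimum:
    every member is at least - p (- w), and subadditivity survives because of two members the
    smaller one serves both arguments. *)
Lemma minimal_sublinear p : sublinear p ->
  exists q, [/\ sublinear q, forall w, q w <= p w &
    forall q', sublinear q' -> (forall w, q' w <= q w) -> q' = q].
Proof.
move=> ps.
pose T := {q : W -> R | sublinear q /\ forall w, q w <= p w}.
pose ge (q1 q2 : T) := `[< forall w, sval q2 w <= sval q1 w >].
have [| | |A Atot|[q [qs qp]] qmin] := @Zorn T ge.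
- by move=> t; apply/asboolP.
- move=> r s t /asboolP rs /asboolP st; apply/asboolP => w.
  exact: le_trans (rs w).
- move=> [s sP] [t tP] /asboolP st /asboolP ts; apply: eq_exist => /=.
  by apply/funext => w; apply/eqP; rewrite eq_le ts st.
- have [[a Aa]|A0] := pselect (A !=set0); last first.
    by exists (exist _ p (conj ps (fun w => lexx _))) => s As; case: A0; exists s.
  pose S w := [set sval f w | f in A].
  have S0 w : S w !=set0 by exists (sval a w), a.
  have Slb w : has_lbound (S w).
    exists (- p (- w)) => _ [f Af <-]; case: f {Af} => f [fs fp] /=.
    by apply: le_trans (sublinear_oppr w fs); rewrite lerN2.
  pose q w := inf (S w).
  have qle f w : A f -> q w <= sval f w.
    by move=> Af; apply: ge_inf => //; exists f.
  have leq w z : (forall f, A f -> z <= sval f w) -> z <= q w.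
    by move=> h; apply: lb_le_inf => // _ [f Af <-]; exact: h.
  have qs : sublinear q.
    split=> [x y|t x t0].
      suff h f : A f -> q (x + y) - q y <= sval f x.
        by rewrite -lerBlDr; exact: leq.
      move=> Af; rewrite lerBlDr [leRHS]addrC -lerBlDr; apply: leq => g Ag.
      rewrite lerBlDr.
      have [/asboolP fg|/asboolP gf] := Atot _ _ Af Ag.
        apply: le_trans (qle _ _ Ag) _.
        apply: le_trans ((svalP g).1.1 _ _) _.
        by have := fg x; lra.
      apply: le_trans (qle _ _ Af) _.
      apply: le_trans ((svalP f).1.1 _ _) _.
      by have := gf y; lra.
    apply/eqP; rewrite eq_le; apply/andP; split.
      move: t0; rewrite [0 <= t]le_eqVlt => /predU1P[<-|t0].
        rewrite rscal0 scale0r mul0r; apply: le_trans (qle _ _ Aa) _.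
        by rewrite (sublinear0 (svalP a).1).
      rewrite -ler_pdivrMl//; apply: leq => f Af.
      by rewrite ler_pdivrMl// -(svalP f).1.2 ?(ltW t0)//; exact: qle.
    apply: leq => f Af; rewrite (svalP f).1.2//.
    by rewrite ler_wpM2l// qle.
  have qp w : q w <= p w by apply: le_trans (qle _ _ Aa) _; exact: (svalP a).2.
  by exists (exist _ q (conj qs qp)) => f Af; apply/asboolP => w; exact: qle.
exists q; split=> // q' q's q'q.
have q'p w : q' w <= p w by exact: le_trans (q'q w) (qp w).
have := qmin (exist _ q' (conj q's q'p)).
by move=> /(_ (asboolT q'q)) [].
Qed.

Lemma hahn_banach_real p : sublinear p ->
  exists g : W -> R, [/\ forall x y, g (x + y) = g x + g y,
    forall t x, g (rscal k t *: x) = t * g x & forall w, g w <= p w].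
Proof.
move=> ps; have [q [qs qp qmin]] := minimal_sublinear ps.
have qD x y : q (x + y) = q x + q y.
  apply/eqP; rewrite eq_le qs.1/=.
  (* Lowering [q] along the ray through (- x, q (- x)) and using minimality gives q x <= - q (- x);
     then q y <= q (- x) + q (x + y) yields superadditivity. *)
  pose C c r := exists2 t, 0 <= t & c = rscal k t *: (- x) /\ r = t * q (- x).
  have [||||q' [q's q'q Cq']] := @sublinear_lower q C qs.
  - by exists 0 => //; rewrite rscal0 scale0r mul0r.
  - move=> c d r s [t t0 [-> ->]] [u u0 [-> ->]]; exists (t + u).
      exact: addr_ge0.
    by rewrite mulrDl -scalerDl rscalD.
  - move=> t c r t0 [u u0 [-> ->]]; exists (t * u); first exact: mulr_ge0.
    by rewrite rscalM scalerA mulrA.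
  - by move=> c r [t t0 [-> ->]]; rewrite qs.2.
  have q'E : q' = q by exact: qmin.
  have : q (- - x) <= - q (- x).
    rewrite -q'E; apply: Cq'; rewrite q'E; exists 1 => //.
    by rewrite rscal1 scale1r mul1r.
  rewrite opprK => qx.
  have := qs.1 (- x) (x + y); rewrite addKr.
  lra.
have qN x : q (- x) = - q x.
  by apply/eqP; rewrite -addr_eq0 -qD addNr sublinear0.
exists q; split=> // t x.
have [t0|t0] := leP 0 t; first exact: qs.2.
rewrite -[t]opprK rscalN scaleNr qN qs.2 ?oppr_ge0 ?(ltW t0)//; ring.
Qed.

End hahn_banach.
End sublinear_theory.

Lemma complexify (R : realType) (k : scalar_kind) (W : lmodType (scalars R k))
    (g : W -> R) :
  (forall x y, g (x + y) = g x + g y) ->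
  (forall t x, g (rscal k t *: x) = t * g x) ->
  exists2 G : W -> (scalars R k)^o, scalar G & forall w, realval (G w) = g w.
Proof.
case: k W g => /= W g gD gZ.
  by exists g => // a x y; rewrite gD gZ.
pose im : R[i] := Complex 0 1.
(* Complex linearity leaves no other choice: the imaginary part of [G w] is minus the real part of
   [G (im *: w)]. *)
exists (fun w => Complex (g w) (- g (im *: w))) => // a x y.
have aE (b : R[i]) :
    b = real_complex R (complex.Re b) + real_complex R (complex.Im b) * im.
  case: b => u v; apply/eqP; rewrite eq_complex /=.
  by rewrite !(mul0r, mulr0, mulr1, addr0, add0r, subr0) !eqxx.
have gC (b : R[i]) z :
    g (b *: z) = complex.Re b * g z + complex.Im b * g (im *: z).
  rewrite [b in LHS]aE scalerDl -scalerA gD (gZ (complex.Re b)).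
  by rewrite (gZ (complex.Im b)).
have ii z : im *: (im *: z) = - z.
  rewrite scalerA -scaleN1r; congr (_ *: _); apply/eqP.
  by rewrite eq_complex /= !(mul0r, mulr0, mulr1, add0r, addr0, sub0r, oppr0) !eqxx.
have gN z : g (- z) = - g z.
  have g0 : g 0 = 0 by have := gD 0 0; rewrite addr0; lra.
  by apply/eqP; rewrite -addr_eq0 -gD addNr g0.
rewrite scalerDr !gD scalerA (mulrC _ a) -scalerA (gC a x) (gC a (_ *: x)) ii gN.
case: a => a b; apply/eqP; rewrite eq_complex /=.
by apply/andP; split; apply/eqP; ring.
Qed.

(** A map [L] takes the place of a subspace; on its kernel [f] vanishes by the bound. Lowering [p]
    along the pairs (L e, Re f e) forces Re G (L e) >= Re f e, and replacing e by - e makes this an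
    equality; scalar multiples of e then give the full values. *)
Lemma hahn_banach_along (R : realType) (k : scalar_kind)
    (E W : lmodType (scalars R k)) (L : E -> W) (f : E -> scalars R k) (p : W -> R) :
  linear L -> scalar f -> seminorm p -> (forall e, modulus (f e) <= p (L e)) ->
  exists G : W -> (scalars R k)^o, [/\ scalar G, forall e, G (L e) = f e &
    forall w, modulus (G w) <= p w].
Proof.
move=> Ll fl [pD pZ] fp.
have L0 : L 0 = 0.
  by have := Ll (-1) 0 0; rewrite scaler0 addr0 scaleN1r addNr.
have f0 := scalar_fun0 fl.
have ps : sublinear p.
  by split=> // t x t0; rewrite pZ modulus_rscal ger0_norm.
pose C w r := exists e, w = L e /\ r = realval (f e).
have [||||q [qs qp Cq]] := @sublinear_lower _ _ _ p C ps.
- by exists 0; rewrite L0 f0 realval0.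
- move=> c d r s [e [-> ->]] [e' [-> ->]]; exists (e + e').
  have := Ll 1 e e'; rewrite !scale1r => ->.
  by have := fl 1 e e'; rewrite scale1r mul1r => ->; rewrite realvalD.
- move=> t c r t0 [e [-> ->]]; exists (rscal k t *: e).
  have := Ll (rscal k t) e 0; rewrite L0 !addr0 => ->.
  by have := fl (rscal k t) e 0; rewrite f0 !addr0 => ->; rewrite realvalM.
- by move=> c r [e [-> ->]]; apply: le_trans (fp e); exact: realval_le_modulus.
have [g [gD gZ gq]] := hahn_banach_real qs.
have [G Gl Gg] := complexify gD gZ.
have GZ := scalar_funZ Gl.
have fZ := scalar_funZ fl.
have LZ a e : L (a *: e) = a *: L e by have := Ll a e 0; rewrite L0 !addr0.
have reE e : realval (G (L e)) = realval (f e).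
  have le e' : realval (f e') <= realval (G (L e')).
    have : g (- L e') <= - realval (f e').
      by apply: le_trans (gq _) _; apply: Cq; exists e'.
    by rewrite -scaleN1r -rscal1 -rscalN gZ Gg; lra.
  apply/eqP; rewrite eq_le le andbT.
  have := le (-1 *: e); rewrite LZ GZ fZ !mulN1r !realvalN; lra.
exists G; split=> // [e|w].
  apply/eqP; rewrite -subr_eq0; apply/eqP/modulus_eq0/eqP.
  rewrite eq_le modulus_ge0 andbT; apply: modulus_le_of_realval => c _.
  by rewrite mulrBr -GZ -LZ -fZ realvalD realvalN reE subrr.
apply: modulus_le_of_realval => c c1.
rewrite -GZ Gg; apply: le_trans (gq _) _; apply: le_trans (qp _) _.
by rewrite pZ c1 mul1r.
Qed.

(** * Weak norms on sequences in the bidual *)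

Section local_duality.
Context (R : realType) (k : scalar_kind).
Local Notation K := (scalars R k).

(** The unit vectors are added to the net so that the maximum over it also bounds each single
    [N (y i)], which pays for the approximation error. *)
Lemma lnorm_ball_net (s : \bar R) m (d : R) : (1 <= s)%E -> 0 < d ->
  exists (J : finType) (c : J -> 'I_m -> K),
    [/\ forall j, lnorm s (fun i => modulus (c j i)) <= 1,
        forall b : 'I_m -> K, lnorm s (fun i => modulus (b i)) <= 1 ->
          exists j, forall i, modulus (b i - c j i) <= d &
        forall i, exists j, forall l, c j l = (l == i)%:R].
Proof.
move=> s1 d0; have [J [cell cellP]] := unit_disc_cells k d0.
pose ball (b : 'I_m -> K) := lnorm s (fun i => modulus (b i)) <= 1.
have ball0 : ball (fun=> 0).
  rewrite /ball (_ : (fun i => _) = (fun=> 0)) ?lnorm0 ?(lt_le_trans lte01)//.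
  by apply/funext => i; rewrite modulus0.
(* Net points have to lie in the ball itself: a product cell that meets the ball is represented by a
   point of the ball, any other cell by the default 0. *)
have /choice[rep repP] (x : {ffun 'I_m -> J}) : exists b, ball b /\
    forall b', ball b' -> (forall i, cell (b' i) = x i) ->
      forall i, cell (b i) = x i.
  have [[b [b1 bx]]|nb] :=
    pselect (exists b, ball b /\ forall i, cell (b i) = x i).
    by exists b.
  by exists (fun=> 0); split=> // b' b'1 b'x; exfalso; apply: nb; exists b'.
have coord b i : ball b -> modulus (b i) <= 1.
  move=> b1; apply: le_trans b1; rewrite -[leLHS]ger0_norm ?modulus_ge0//.
  exact: (ler_norm_lnorm (fun i => modulus (b i))).
exists ({ffun 'I_m -> J} + 'I_m)%type, (fun j => match j with
  | inl x => rep x | inr i => fun l => (l == i)%:R end); split.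
- case=> [x|i]; first exact: (repP x).1.
  apply: le_trans (lnorm_le_sum s1 (fun l => modulus_ge0 _)) _.
  rewrite (bigD1 i)//= eqxx modulus1 big1 ?addr0// => l /negPf ->.
  exact: modulus0.
- move=> b b1; pose x := [ffun i => cell (b i)].
  have bx i : cell (b i) = x i by rewrite ffunE.
  exists (inl x) => i; apply: cellP; [exact: coord|exact/coord/(repP x).1|].
  by rewrite bx; apply/esym; exact: (repP x).2 b b1 bx i.
- by move=> i; exists (inr i).
Qed.

Context (E : lmodType K) (N : E -> R) (N_semi : seminorm N).

Lemma seminorm_ge0 x : 0 <= N x.
Proof.
have [ND NZ] := N_semi.
have N0 : N 0 = 0 by have := NZ 0 0; rewrite scale0r modulus0 mul0r.
have := ND x (-1 *: x); rewrite NZ modulusN modulus1 scaleN1r addrN N0; lra.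
Qed.

Lemma seminorm_homogeneous : pos_homogeneous N.
Proof.
split=> [|t x t0]; first exact: seminorm_ge0.
by rewrite N_semi.2 modulus_rscal gtr0_norm.
Qed.

Lemma seminorm_sum (J : finType) (F : J -> E) : N (\sum_j F j) <= \sum_j N (F j).
Proof.
elim/big_rec2: _ => [|j x y _ h].
  by have := N_semi.2 0 0; rewrite scale0r modulus0 mul0r => ->.
by apply: le_trans (N_semi.1 _ _) _; rewrite lerD2l.
Qed.

Definition max_seminorm (J : finType) (w : J -> E) : R :=
  \big[Num.max/0]_j N (w j).

Lemma max_seminorm_ge (J : finType) (w : J -> E) j : N (w j) <= max_seminorm w.
Proof. exact: le_bigmax. Qed.

Lemma max_seminorm_ge0 (J : finType) (w : J -> E) : 0 <= max_seminorm w.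
Proof. exact: bigmax_ge_id. Qed.

Lemma max_seminormP (J : finType) : seminorm (@max_seminorm J).
Proof.
split=> [v w|a w].
  apply: bigmax_le => [|j _]; first by rewrite addr_ge0 ?max_seminorm_ge0.
  by apply: le_trans (N_semi.1 _ _) _; rewrite lerD ?max_seminorm_ge.
rewrite /max_seminorm; elim/big_rec2: _ => [|j x y _ ->]; first by rewrite mulr0.
by rewrite maxr_pMr ?modulus_ge0// N_semi.2.
Qed.

(** The weak norm is controlled by the norms of sum_i b_i y_i with [b] in the conjugate ball.
    Replacing [b] by a net point costs at most m d P, where [P] is the maximum over the net, since
    the unit vectors give N (y i) <= P. *)
Lemma weak_lnorm_le_net (s : \bar R) m (d : R) (J : finType)
    (c : J -> 'I_m -> K) (y : 'I_m -> E) : (1 <= s)%E -> 0 <= d ->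
  (forall b : 'I_m -> K,
    lnorm (hoelder_conjugate s) (fun i => modulus (b i)) <= 1 ->
    exists j, forall i, modulus (b i - c j i) <= d) ->
  (forall i, exists j, forall l, c j l = (l == i)%:R) ->
  weak_lnorm N s y <=
    (1 + m%:R * d) * max_seminorm (fun j => \sum_i c j i *: y i).
Proof.
move=> s1 d0 net basis; set P := max_seminorm _.
have yP i : N (y i) <= P.
  have [j cj] := basis i.
  have := max_seminorm_ge (fun j => \sum_i c j i *: y i) j.
  rewrite (bigD1 i)//= cj eqxx scale1r big1 ?addr0// => l /negPf li.
  by rewrite cj li scale0r.
apply: weak_lnorm_le => f f1; apply: lnorm_le_of_pairing s1 _ => b b1.
have -> : \sum_i b i * f (y i) = f (\sum_i b i *: y i).
  elim/big_rec2: _ => [|i u v _ ->]; first by rewrite (scalar_fun0 (dual_scalar f)).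
  by rewrite (dual_scalar f).
apply: le_trans (modulus_dual_ball seminorm_homogeneous _ f1) _.
have [j cj] := net b b1.
have -> : \sum_i b i *: y i = \sum_i c j i *: y i + \sum_i (b i - c j i) *: y i.
  by rewrite -big_split/=; apply: eq_bigr => i _; rewrite -scalerDl addrC subrK.
apply: le_trans (N_semi.1 _ _) _; rewrite mulrDl mul1r lerD//.
  exact: (max_seminorm_ge (fun j => \sum_i c j i *: y i) j).
apply: le_trans (seminorm_sum _) _.
apply: (@le_trans _ _ (\sum_(i < m) d * P)).
  apply: ler_sum => i _; rewrite N_semi.2.
  by apply: ler_pM; rewrite ?modulus_ge0 ?seminorm_ge0.
by rewrite sumr_const card_ord -mulrA mulr_natl.
Qed.

(** Half of the duality of l_oo-sums and l_1-sums: each coordinate of [w] nearly norms its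
    functional and is rotated so that the values are nonnegative reals, which add up without
    cancellation. *)
Lemma dual_norm_sum_le (J : finType) (psi : J -> dual N) (B : R) : 0 <= B ->
  (forall w : J -> E, modulus (\sum_j psi j (w j)) <= B * max_seminorm w) ->
  \sum_j dual_norm (psi j) <= B.
Proof.
move=> B0 psiB; apply/ler_addgt0Pr => e e0.
(* Each coordinate loses at most [d], in all at most [e]; the successor keeps [d] positive when [J]
   is empty. *)
pose d := e / (#|J|.+1)%:R.
have d0 : 0 < d by rewrite divr_gt0.
have /choice[w wP] j : exists w,
    N w <= 1 /\ dual_norm (psi j) - d <= realval (psi j w).
  pose A := [set modulus (psi j x) | x in [set x | N x <= 1]].
  have supA : has_sup A.
    split.
      exists (modulus (psi j 0)), 0 => //=.
      by have := N_semi.2 0 0; rewrite scale0r modulus0 mul0r => ->.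
    exists (dual_norm (psi j)) => _ [x /= x1 <-].
    apply: le_trans (modulus_dual_le seminorm_homogeneous _ _) _.
    by rewrite ler_piMr// opnorm_ge0.
  have [_ [x /= x1 <-] dx] := sup_adherent d0 supA.
  have [a a1 ax] := unimodular_rotation (psi j x).
  exists (a *: x); rewrite N_semi.2 a1 mul1r; split=> //.
  by rewrite (scalar_funZ (dual_scalar (psi j))) ax realval_rscal; exact: ltW.
have := psiB w.
have : max_seminorm w <= 1.
  by apply: bigmax_le => // j _; exact: (wP j).1.
move=> w1 h; have {}h := le_trans (realval_le_modulus _) h.
rewrite realval_sum in h.
have : \sum_j (dual_norm (psi j) - d) <= \sum_j realval (psi j (w j)).
  by apply: ler_sum => j _; exact: (wP j).2.
rewrite big_split/= sumr_const -mulr_natl => h'.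
have : B * max_seminorm w <= B by rewrite ler_piMr.
have : #|J|%:R * d <= e.
  rewrite /d mulrCA ler_piMr ?(ltW e0)// ler_pdivrMr ?ltr0n// mul1r ler_nat.
  exact: leqnSn.
by move: h h'; rewrite mulrN; lra.
Qed.

Lemma weak_lnorm_bidual (s : \bar R) m (phi : 'I_m -> dual N) (B : R)
    (v : 'I_m -> dual (@dual_norm R k E N)) : (1 <= s)%E -> 0 <= B ->
  (forall y : 'I_m -> E,
    modulus (\sum_i phi i (y i)) <= B * weak_lnorm N s y) ->
  modulus (\sum_i v i (phi i)) <=
    B * weak_lnorm (@dual_norm R k _ (@dual_norm R k E N)) s v.
Proof.
move=> s1 B0 phiB; set W := weak_lnorm _ s v.
have N_hom := seminorm_homogeneous.
have W0 : 0 <= W by exact: weak_lnorm_ge0.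
(* A net of mesh [d] loses the factor 1 + m d, which disappears in the limit. *)
suff main d : 0 < d -> modulus (\sum_i v i (phi i)) <= (1 + m%:R * d) * (B * W).
  apply/ler_addgt0Pr => e e0.
  pose D := m%:R * (B * W) + 1.
  have D0 : 0 < D by rewrite ltr_wpDl// !mulr_ge0.
  apply: le_trans (main (e / D) (divr_gt0 e0 D0)) _.
  have : m%:R * (B * W) <= D by rewrite lerDl.
  move: (B * W) D D0 => z D D0 zD; rewrite mulrDl mul1r lerD2l.
  have -> : m%:R * (e / D) * z = e * (m%:R * z / D) by ring.
  by rewrite ler_piMr ?(ltW e0)// ler_pdivrMr// mul1r.
move=> d0.
have [J [c [c1 net basis]]] := lnorm_ball_net m (hoelder_conj_ge1 s1) d0.
pose L (y : 'I_m -> E) : J -> E := fun j => \sum_i c j i *: y i.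
pose f (y : 'I_m -> E) : K^o := \sum_i phi i (y i).
have Ll : linear L.
  move=> a x y; apply/funext => j; rewrite /L !fctE scaler_sumr -big_split/=.
  by apply: eq_bigr => i _; rewrite scalerDr !scalerA mulrC.
have fl : scalar f.
  move=> a x y; rewrite /f mulr_sumr -big_split/=; apply: eq_bigr => i _.
  exact: (dual_scalar (phi i)).
pose B' := B * (1 + m%:R * d).
have B'0 : 0 <= B' by rewrite mulr_ge0// addr_ge0// mulr_ge0// ltW.
pose p (w : J -> E) := B' * max_seminorm w.
have ps : seminorm p.
  have [MD MZ] := max_seminormP J.
  split=> [x y|a x]; rewrite /p.
    by rewrite -mulrDr ler_wpM2l.
  by rewrite MZ mulrCA.
have fp y : modulus (f y) <= p (L y).
  apply: le_trans (phiB y) _; rewrite /p /B' -mulrA ler_wpM2l//.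
  exact: weak_lnorm_le_net (ltW d0) net basis.
have [G [Gl GL Gp]] := hahn_banach_along Ll fl ps fp.
pose at_ j (x : E) : J -> E := fun l => if l == j then x else 0.
have psil j : scalar (fun x => G (at_ j x)).
  move=> a x y; rewrite -Gl; congr G; apply/funext => l.
  by rewrite /at_ !fctE; case: eqP; rewrite // scaler0 addr0.
have psib j x : modulus (G (at_ j x)) <= B' * N x.
  apply: le_trans (Gp _) _; rewrite ler_wpM2l//.
  apply: bigmax_le => [|l _]; first exact: seminorm_ge0.
  rewrite /at_; case: eqP => // _.
  have := N_semi.2 0 0; rewrite scale0r modulus0 mul0r => ->.
  exact: seminorm_ge0.
pose psi j := Dual (dual_of_bound (psil j) (psib j)).
have Gsum w : G w = \sum_j psi j (w j).
  have -> : w = \sum_j at_ j (w j).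
    apply/funext => l; rewrite fct_sumE (bigD1 l)//= /at_ eqxx big1 ?addr0//.
    by move=> j /negPf; rewrite eq_sym => ->.
  rewrite (big_morph G (scalar_funD Gl) (scalar_fun0 Gl)).
  apply: eq_bigr => j _ /=; congr (G (at_ j _)).
  rewrite fct_sumE (bigD1 j)//= /at_ eqxx big1 ?addr0// => l /negPf.
  by rewrite eq_sym => ->.
have psiB : \sum_j dual_norm (psi j) <= B'.
  by apply: dual_norm_sum_le => // w; rewrite -Gsum.
(* Evaluate [G] on [L y] for a sequence [y] supported at the index [i]. *)
have phiE i : phi i = \sum_j c j i *: psi j.
  apply: val_inj; apply/funext => x.
  have -> : val (\sum_j c j i *: psi j) x = \sum_j c j i * psi j x.
    exact: (dual_sum (fun j => c j i *: psi j) x).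
  pose y : 'I_m -> E := fun l => if l == i then x else 0.
  have p0 l : phi l 0 = 0 := scalar_fun0 (dual_scalar (phi l)).
  rewrite -[LHS]/(phi i x); have <- : f y = phi i x.
    by rewrite /f (bigD1 i)//= /y eqxx big1 ?addr0// => l /negPf ->.
  rewrite -GL Gsum; apply: eq_bigr => j _.
  have -> : L y j = c j i *: x.
    by rewrite /L (bigD1 i)//= /y eqxx big1 ?addr0// => l /negPf ->; rewrite scaler0.
  exact: scalar_funZ (dual_scalar (psi j)) _ _.
have vphi i : v i (phi i) = \sum_j c j i * v i (psi j).
  rewrite phiE; elim/big_rec2: _ => [|j u z _ <-].
    exact: scalar_fun0 (dual_scalar (v i)).
  by rewrite (dual_scalar (v i)).
(* Regrouped by net points, [psi j] is paired with the combination of the [v i] by [c j], whose norm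
   is shown to be at most [W]. *)
rewrite (eq_bigr _ (fun i _ => vphi i)) exchange_big/=.
apply: le_trans (modulus_sum _ _ _) _.
apply: (@le_trans _ _ (\sum_j W * dual_norm (psi j))); last first.
  by rewrite -mulr_sumr mulrC mulrA [(1 + _) * B]mulrC ler_wpM2r.
apply: ler_sum => j _.
pose u := \sum_i c j i *: v i.
have uE g : u g = \sum_i c j i * v i g.
  exact: (dual_sum (fun i => c j i *: v i) g).
rewrite -uE.
have dhom := dual_norm_homogeneous N_hom.
apply: le_trans (modulus_dual_le dhom u (psi j)) _.
rewrite ler_wpM2r ?opnorm_ge0//.
rewrite /dual_norm /opnorm; apply: ge_sup => [|_ [g /= g1 <-]].
  exists (modulus (u 0)), 0 => //=; exact: dual_ball0.
rewrite uE; apply: le_trans (hoelder_modulus _ _ (hoelder_conj_ge1 s1)) _.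
rewrite hoelder_conjugateK.
apply: le_trans (ler_wpM2r (lnorm_ge0 _ _) (c1 j)) _; rewrite mul1r.
(* Through the embedding, [g] is one of the functionals on the bidual that test the weak norm of
   [v]. *)
have eg1 : dual_ball (bidual_embedding dhom g).
  exact: le_trans (bidual_embedding_le dhom g) g1.
exact: (lnorm_le_weak (dual_norm_homogeneous dhom) s1 v eg1).
Qed.

End local_duality.

(** * Dominated operators and the Lapreste norm *)

Section exponents.
Context (R : realType).
Implicit Types p q : \bar R.
Local Open Scope ereal_scope.

Lemma residual_exponent_ge1 p q : 1 <= p -> 1 <= q -> p^-1 + q^-1 <= 1 ->
  1 <= residual_exponent p q.
Proof.
move=> p1 q1 pq.
have p0 : 0 <= p^-1 by rewrite inve_ge0 (le_trans lee01).
have q0 : 0 <= q^-1 by rewrite inve_ge0 (le_trans lee01).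
have pf : p^-1 \is a fin_num.
  by rewrite ge0_fin_numE // (@le_lt_trans _ _ 1) ?ltry// (le_trans _ pq)// leeDl.
have qf : q^-1 \is a fin_num.
  by rewrite ge0_fin_numE // (@le_lt_trans _ _ 1) ?ltry// (le_trans _ pq)// leeDr.
rewrite /residual_exponent inve_ge1.
  by move: p0 q0; rewrite -(fineK pf) -(fineK qf) !lee_fin; lra.
by move: pq; rewrite -(fineK pf) -(fineK qf) !lee_fin; lra.
Qed.

End exponents.

Section lapreste_duality.
Context (R : realType) (k : scalar_kind).
Local Notation K := (scalars R k).
Context (I : finType) (i0 : I) (X : I -> completeNormedModType K).
Context (Y : completeNormedModType K) (beta : tensor X -> R).
Context (p q : \bar R) (hp : (1 <= p)%E) (hq : (1 <= q)%E).
Context (hpq : (p^-1 + q^-1 <= 1)%E).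

Local Notation r := (residual_exponent p q).
Local Notation YD := (dual (@vnorm R k Y)).
Local Notation normYD := (@dual_norm R k Y (@vnorm R k Y)).
Local Notation alpha :=
  (@lapreste R k I X Y beta (hoelder_conjugate q) (hoelder_conjugate p)).
Local Notation operators := (dominated beta normYD hp hq hpq).

Let r_ge1 : (1 <= r)%E := residual_exponent_ge1 hp hq hpq.

Lemma vnorm_seminorm : seminorm (@vnorm R k Y).
Proof. by split; [exact: vnormD | exact: vnormZ]. Qed.

Let Y_hom := seminorm_homogeneous vnorm_seminorm.

(** Points of the product replace members of [Sigma], and double conjugates of exponents are
    cancelled, so that the data match those quantified in [dominated_by]. *)
Definition represents (u : tensor (adjoin X Y)) (c : R) m (l : 'I_m -> K)
    (x z : 'I_m -> forall i, X i) (y : 'I_m -> Y) :=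
  u = \sum_i l i *: tens_right (tens (x i) - tens (z i)) (y i) /\
  c = lnorm r (fun i => modulus (l i))
      * weak_diff_lnorm beta p (fun i => tens (x i)) (fun i => tens (z i))
      * weak_lnorm (@vnorm R k Y) q y.

Lemma lapresteE u :
  alpha u = inf [set c | exists m l x z y, @represents u c m l x z y].
Proof.
rewrite /lapreste /= !hoelder_conjugateK; congr inf; apply/seteqP; split => c /=.
  move=> [m [l [a [b [y [ab -> ->]]]]]].
  have /choice[x xa] i : exists x, tens x = a i.
    by have [[x _ xa] _] := ab i; exists x.
  have /choice[z zb] i : exists z, tens z = b i.
    by have [_ [z _ zb]] := ab i; exists z.
  have -> : a = fun i => tens (x i) by apply/funext => i.
  have -> : b = fun i => tens (z i) by apply/funext => i.
  by exists m, l, x, z, y.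
move=> [m [l [x [z [y [-> ->]]]]]].
exists m, l, (fun i => tens (x i)), (fun i => tens (z i)), y; split=> // i.
by split; [exists (x i) | exists (z i)].
Qed.

Lemma weak_diff_lnorm_ge0 s m (a b : 'I_m -> tensor X) :
  0 <= weak_diff_lnorm beta s a b.
Proof. by apply: sup_set_ge0 => _ [f _ <-]; exact: lnorm_ge0. Qed.

Lemma represents_ge0 u c m l x z y : @represents u c m l x z y -> 0 <= c.
Proof.
move=> [_ ->]; rewrite !mulr_ge0 ?lnorm_ge0 ?weak_diff_lnorm_ge0//.
exact: weak_lnorm_ge0.
Qed.

Lemma lapreste_le u c m l x z y : @represents u c m l x z y -> alpha u <= c.
Proof.
move=> uc; rewrite lapresteE; apply: ge_inf; last by exists m, l, x, z, y.
by exists 0 => d [m' [l' [x' [z' [y']]]]]; exact: represents_ge0.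
Qed.

(** A multilinear form in at least one variable, here [i0], vanishes at the zero family. Hence every
    elementary tensor is a difference of two members of [Sigma]. *)
Lemma tens0 : tens (X := X) (fun=> 0) = 0.
Proof.
apply: val_inj; apply/funext => phi /=.
have /asboolP phil := valP phi.
rewrite /evaluation (_ : (fun=> 0) = dfwith (fun i : I => 0 : X i) i0 0).
  exact: (scalar_fun0 (phil i0 (fun=> 0))).
apply: functional_extensionality_dep => i.
by have [<-|ii] := eqVneq i0 i; rewrite ?dfwithin// dfwithout.
Qed.

Lemma adjoin_pt_eta (w : forall o, adjoin X Y o) :
  w = adjoin_pt (fun i => w (Some i)) (w None).
Proof. by apply: functional_extensionality_dep; case. Qed.

(** Makes the infimum range over a nonempty set, so that lower bounds pass to it; [inf] of the empty
    set would be the default 0. *)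
Lemma represents_span u : exists c m l x z y, @represents u c m l x z y.
Proof.
have [m [l [w uE]]] := tensor_span u.
do 2 eexists; exists l, (fun j i => w j (Some i)), (fun=> fun=> 0).
exists (fun j => w j None); split; last by [].
rewrite uE; apply: eq_bigr => j _.
by rewrite tens0 subr0 tens_right_tens -adjoin_pt_eta.
Qed.

Lemma le_lapreste u A :
  (forall c m l x z y, @represents u c m l x z y -> A <= c) -> A <= alpha u.
Proof.
move=> h; rewrite lapresteE; apply: lb_le_inf => [|c [m [l [x [z [y]]]]]].
  have [c [m [l [x [z [y uc]]]]]] := represents_span u.
  by exists c, m, l, x, z, y.
exact: h.
Qed.

Lemma lapreste_homogeneous : pos_homogeneous alpha.
Proof.
split=> [u|t u t0].
  by apply: le_lapreste => c m l x z y; exact: represents_ge0.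
rewrite -ler_pdivrMl//; apply: le_lapreste => c m l x z y [-> ->].
rewrite ler_pdivrMl//.
apply: (@lapreste_le _ _ m (fun i => rscal k t * l i) x z y); split.
  by rewrite scaler_sumr; apply: eq_bigr => i _; rewrite scalerA.
rewrite (_ : (fun i => modulus (rscal k t * l i)) = (fun i => t * modulus (l i))).
  by rewrite lnormZ ?(ltW t0)// !mulrA.
by apply/funext => i; rewrite modulusM modulus_rscal gtr0_norm.
Qed.

(** * Bounded functionals from dominated operators *)

Section functional_of_operator.
Context (T : multilinear X YD).

Lemma operator_form_multilinear :
  (fun w : forall o, adjoin X Y o => T (fun i => w (Some i)) (w None) : K^o)
    \in @multilinear_pred R k _ (adjoin X Y) K^o.
Proof.
have /asboolP Tm := valP T.
apply/asboolP => -[i|] w a t u; last first.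
  have h v : T (fun i => dfwith w None v (Some i)) (dfwith w None v None) =
      T (fun i => w (Some i)) v.
    rewrite dfwithin; congr (T _ v).
    by apply: functional_extensionality_dep => i; rewrite dfwithout.
  by rewrite !h; exact: dual_scalar.
have h v : T (fun j => dfwith w (Some i) v (Some j)) (dfwith w (Some i) v None) =
    T (dfwith (fun j => w (Some j)) i v) (w None).
  rewrite dfwithout//; congr (T _ (w None)).
  apply: functional_extensionality_dep => j.
  have [<-|ij] := eqVneq i j.
    by rewrite (@dfwithin _ (adjoin X Y) _ (Some i)) dfwithin.
  by rewrite (@dfwithout _ (adjoin X Y) _ (Some i) _ (Some j)) // dfwithout.
by rewrite !h Tm.
Qed.

Definition operator_form : Defs.form (adjoin X Y) :=
  Multilinear operator_form_multilinear.

Lemma operator_form_sum m (l : 'I_m -> K) (x z : 'I_m -> forall i, X i)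
    (y : 'I_m -> Y) :
  linearization operator_form
    (\sum_i l i *: tens_right (tens (x i) - tens (z i)) (y i)) =
  \sum_i l i * (T (x i) - T (z i)) (y i).
Proof.
have ls := linearization_scalar operator_form.
rewrite (big_morph _ (scalar_funD ls) (scalar_fun0 ls)).
by apply: eq_bigr => i _; rewrite (scalar_funZ ls).
Qed.

Lemma operator_form_le (C : R) u : 0 < C -> Defs.dominated_by beta p q normYD C T ->
  modulus (linearization operator_form u) <= C * alpha u.
Proof.
move=> C0 TC; rewrite -ler_pdivrMl//; apply: le_lapreste => c m l x z y [-> ->].
rewrite ler_pdivrMl// operator_form_sum.
apply: le_trans (hoelder_modulus _ _ r_ge1) _.
rewrite -mulrA mulrCA ler_wpM2l ?lnorm_ge0//.
(* Domination is tested at the images of the [y i] in the bidual, whose values at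
   [T (x i) - T (z i)] are by definition the pairings with [y i]. *)
apply: le_trans (TC m x z (fun i => bidual_embedding Y_hom (y i))) _.
rewrite -mulrA ler_pM2l// ler_wpM2l ?weak_diff_lnorm_ge0//.
exact: weak_lnorm_bidual_embedding.
Qed.

End functional_of_operator.

(** * Dominated operators from bounded functionals *)

Section operator_of_functional.
Context (f : tensor (adjoin X Y) -> K^o) (A : R).
Context (f_scalar : scalar f) (A_ge0 : 0 <= A).
Context (f_le : forall u, modulus (f u) <= A * alpha u).

Lemma functional_section_bound (x : forall i, X i) : exists C : R, forall y : Y,
  modulus (f (tens (adjoin_pt x y))) <= C * vnorm y.
Proof.
(* The elementary tensor is represented by one term with second point zero. The constant may depend
   on [x]: it serves to place the section at [x] in the dual of [Y]. *)
pose W := weak_diff_lnorm beta p (fun _ : 'I_1 => tens x) (fun=> tens (fun=> 0)).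
exists (A * (lnorm r (fun _ : 'I_1 => modulus (1 : K)) * W)) => y.
apply: le_trans (f_le _) _; rewrite -mulrA ler_wpM2l//.
apply: (@le_trans _ _ (lnorm r (fun _ : 'I_1 => modulus (1 : K)) * W *
    weak_lnorm (@vnorm R k Y) q (fun _ : 'I_1 => y))).
  apply: (@lapreste_le _ _ 1%N (fun=> 1) (fun=> x) (fun=> fun=> 0) (fun=> y)).
  split=> //.
  by rewrite big_ord1 scale1r tens0 subr0 tens_right_tens.
apply: ler_wpM2l; first by rewrite mulr_ge0 ?lnorm_ge0 ?weak_diff_lnorm_ge0.
by apply: le_trans (weak_lnorm_le_sum Y_hom hq _) _; rewrite big_ord1.
Qed.

Lemma tens_linear_at (J : finType) (Z : J -> completeNormedModType K)
  (w : forall j, Z j) j : linear (fun t : Z j => tens (dfwith w j t)).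
Proof.
move=> a t u; apply: val_inj; apply/funext => phi /=.
by have /asboolP phil := valP phi; exact: (phil j w).
Qed.

Lemma adjoin_pt_dfwith (x : forall i, X i) i (t : X i) (y : Y) :
  adjoin_pt (dfwith x i t) y =
  dfwith (T := adjoin X Y) (adjoin_pt x y) (Some i) t.
Proof.
apply: functional_extensionality_dep => -[j|] /=; last by rewrite dfwithout.
have [<-|ij] := eqVneq i j.
  by rewrite dfwithin (@dfwithin _ (adjoin X Y) _ (Some i)).
by rewrite dfwithout // (@dfwithout _ (adjoin X Y) _ (Some i) _ (Some j)).
Qed.

Lemma adjoin_pt_dfwith_None (x : forall i, X i) (y t : Y) :
  adjoin_pt x t = dfwith (T := adjoin X Y) (adjoin_pt x y) None t.
Proof.
apply: functional_extensionality_dep => -[j|] /=; first by rewrite dfwithout.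
by rewrite (@dfwithin _ (adjoin X Y) _ None).
Qed.

Lemma functional_section_dual (x : forall i, X i) :
  (fun y : Y => f (tens (adjoin_pt x y))) \in dual_pred (@vnorm R k Y).
Proof.
have [C fC] := functional_section_bound x.
apply: dual_of_bound fC => a y y'.
pose g := adjoin_pt_dfwith_None x 0.
rewrite (g (a *: y + y')) (g y) (g y').
by rewrite (tens_linear_at (adjoin_pt x 0) (j := None)) f_scalar.
Qed.

Definition functional_section x : YD := Dual (functional_section_dual x).

Lemma functional_section_multilinear :
  functional_section \in @multilinear_pred R k I X YD.
Proof.
apply/asboolP => i x a t u; apply: val_inj; apply/funext => y.
rewrite -[RHS]/(a * f (tens (adjoin_pt (dfwith x i t) y)) +
  f (tens (adjoin_pt (dfwith x i u) y))) /= !adjoin_pt_dfwith.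
by rewrite (tens_linear_at (adjoin_pt x y) (j := Some i)) f_scalar.
Qed.

Definition functional_operator : multilinear X YD :=
  Multilinear functional_section_multilinear.

(** Coefficients [l] in the ball of l_r linearize the l_r* norm. For fixed [l], [x] and [z], the
    bound on [f] estimates sum_i phi_i(y_i) by [A * D] times the weak q-norm of [y], and
    [weak_lnorm_bidual] transfers this to [v]. *)
Lemma functional_operator_dominated :
  Defs.dominated_by beta p q normYD A functional_operator.
Proof.
move=> m x z v; set T := functional_operator.
set D := weak_diff_lnorm _ _ _ _.
apply: lnorm_le_of_pairing => [|l]; first exact: hoelder_conj_ge1.
rewrite hoelder_conjugateK => l1.
pose phi i := l i *: (T (x i) - T (z i)).
have vphi i : l i * v i (T (x i) - T (z i)) = v i (phi i).
  by rewrite (scalar_funZ (dual_scalar (v i))).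
rewrite (eq_bigr _ (fun i _ => vphi i)).
apply: (@weak_lnorm_bidual _ _ _ _ vnorm_seminorm q m phi (A * D) v hq) => [|y].
  by rewrite mulr_ge0// weak_diff_lnorm_ge0.
have -> : \sum_i phi i (y i) =
    f (\sum_i l i *: tens_right (tens (x i) - tens (z i)) (y i)).
  rewrite (big_morph f (scalar_funD f_scalar) (scalar_fun0 f_scalar)).
  apply: eq_bigr => i _; rewrite (scalar_funZ f_scalar).
  have -> : tens_right (tens (x i) - tens (z i)) (y i) =
      tens (adjoin_pt (x i) (y i)) - tens (adjoin_pt (z i) (y i)).
    exact: val_inj.
  by rewrite -scaleN1r addrC f_scalar mulN1r addrC.
apply: le_trans (f_le _) _; rewrite -mulrA ler_wpM2l//.
apply: (le_trans (lapreste_le (conj erefl erefl))).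
rewrite -/D ler_wpM2r ?weak_lnorm_ge0//.
by rewrite ler_piMl// weak_diff_lnorm_ge0.
Qed.

End operator_of_functional.

(** * The isometric isomorphism *)

Lemma lapreste_functional_subproof (T : operators) :
  (linearization (operator_form T) : tensor (adjoin X Y) -> K^o) \in dual_pred alpha.
Proof.
have /asboolP[C C0 TC] := valP T.
by apply: (@dual_of_bound _ _ _ _ _ C) => // u; exact: operator_form_le.
Qed.

Definition lapreste_functional (T : operators) : dual alpha :=
  Dual (lapreste_functional_subproof T).

Lemma lapreste_functional_tens T x y :
  lapreste_functional T (tens (adjoin_pt x y)) = T x y.
Proof. by []. Qed.

Lemma eq_dual_tens (f g : dual alpha) :
  (forall x y, f (tens (adjoin_pt x y)) = g (tens (adjoin_pt x y))) -> f = g.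
Proof.
move=> fg; apply: val_inj; apply/funext => u.
have [m [l [w ->]]] := tensor_span u.
have fs := dual_scalar f; have gs := dual_scalar g.
rewrite -[LHS]/(f _) -[RHS]/(g _).
rewrite (big_morph f (scalar_funD fs) (scalar_fun0 fs)).
rewrite (big_morph g (scalar_funD gs) (scalar_fun0 gs)).
apply: eq_bigr => j _; rewrite (scalar_funZ fs) (scalar_funZ gs).
by rewrite [w j]adjoin_pt_eta fg.
Qed.

Lemma lapreste_functional_linear : linear lapreste_functional.
Proof.
move=> a S T; apply: eq_dual_tens => x y; rewrite lapreste_functional_tens.
rewrite -[LHS]/((a *: dominated_op S + dominated_op T) x y).
rewrite -[RHS]/(a * lapreste_functional S (tens (adjoin_pt x y)) +
  lapreste_functional T (tens (adjoin_pt x y))) !lapreste_functional_tens.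
move: (dominated_op S) (dominated_op T) => {}S {}T.
rewrite -[LHS]/((a *: S x + T x) y).
by move: (S x) (T x).
Qed.

HB.instance Definition _ := GRing.isLinear.Build K operators (dual alpha) *:%R
  lapreste_functional lapreste_functional_linear.

Lemma lapreste_functional_norm T :
  dual_norm (lapreste_functional T) = dominated_norm T.
Proof.
have /asboolP[C0 C0_gt0 TC0] := valP T.
apply/eqP; rewrite eq_le; apply/andP; split.
  apply: lb_le_inf => [|C [C_gt0 TC]]; first by exists C0.
  by apply: opnorm_le => [|u]; [exact: ltW | exact: operator_form_le].
(* Domination constants have to be positive whereas [A] may be 0, hence the room [e]. The operator
   recovered from the functional of [T] is [T] itself, so the bound on the functional makes [A + e]
   a constant for [T]. *)
apply/ler_addgt0Pr => e e0; set A := dual_norm _.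
have A0 : 0 <= A by exact: opnorm_ge0.
apply: ge_inf; first by exists 0 => C [/ltW].
split; first by rewrite ltr_wpDl.
have Ae0 : 0 <= A + e by rewrite addr_ge0// ltW.
have f_le u : modulus (lapreste_functional T u) <= (A + e) * alpha u.
  apply: le_trans (modulus_dual_le lapreste_homogeneous _ _) _.
  by rewrite ler_wpM2r ?lapreste_homogeneous.1// lerDl ltW.
have := functional_operator_dominated (dual_scalar _) Ae0 f_le.
congr Defs.dominated_by; apply/funext => x; apply: val_inj.
by apply/funext => y.
Qed.

Lemma lapreste_functional_bij : bijective lapreste_functional.
Proof.
have inj : injective lapreste_functional.
  move=> S T ST; apply: val_inj; apply: val_inj; apply/funext => x.
  apply: val_inj; apply/funext => y.
  by have := lapreste_functional_tens S x y; rewrite ST.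
suff /choice[g gK] f : exists T, lapreste_functional T = f.
  by exists g => // T; apply: inj; rewrite gK.
have f_le u : modulus (f u) <= dual_norm f * alpha u.
  exact: modulus_dual_le lapreste_homogeneous _ _.
have A0 : 0 <= dual_norm f by exact: opnorm_ge0.
pose U := functional_operator (dual_scalar f) A0 f_le.
have Ud : U \in dominated_pred beta normYD hp hq hpq.
  (* The summand 1 keeps the constant positive even when [f] is zero. *)
  apply/asboolP; exists (dual_norm f + 1) => [|m x z v]; first by rewrite ltr_wpDl.
  apply: le_trans (functional_operator_dominated (dual_scalar f) A0 f_le x z v) _.
  rewrite -!mulrA ler_wpM2r ?lerDl// mulr_ge0 ?weak_diff_lnorm_ge0//.
  exact: weak_lnorm_ge0.
by exists (Dominated Ud); apply: eq_dual_tens.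
Qed.

End lapreste_duality.

Theorem theorem4p7 (R : realType) (k : scalar_kind) (n : nat) (hn : (0 < n)%N)
    (X : 'I_n -> completeNormedModType (scalars R k))
    (Y : completeNormedModType (scalars R k))
    (beta : tensor X -> R) (hbeta : reasonable_crossnorm beta)
    (p q : \bar R) (hp : (1 <= p)%E) (hq : (1 <= q)%E)
    (hpq : (p^-1 + q^-1 <= 1)%E) :
  exists Phi :
    {linear dominated beta (@dual_norm R k Y (@vnorm R k Y)) hp hq hpq ->
            dual (@lapreste R k _ X Y beta
                    (hoelder_conjugate q) (hoelder_conjugate p))},
  [/\ bijective Phi,
      forall T, dual_norm (Phi T) = dominated_norm T &
      forall T (x : forall i, X i) (y : Y),
        Phi T (tens (adjoin_pt x y)) = T x y].
Proof.
pose i0 : 'I_n := Ordinal hn.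
exists (@lapreste_functional R k _ i0 X Y beta p q hp hq hpq); split.
- exact: lapreste_functional_bij.
- exact: lapreste_functional_norm.
- exact: lapreste_functional_tens.
Qed.
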